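(* Let $P$ be a maximal lattice polygon with $g$ interior lattice points and lattice width $d>1$. Then \[ \dim(\mathbb{M}_P)\leq g+\frac{2g}{d-1}+2d-3. \]
   Context: Lattice polygon: convex hull of a nonempty finite subset of $\mathbb{Z}^2$; $P$ is maximal if not properly contained in another lattice polygon with the same interior polygon (the convex hull of the interior lattice points). Lattice width: least $s$ such that some map $x\mapsto Ax+b$ ($A\in\mathrm{GL}_2(\mathbb{Z})$, $b\in\mathbb{Z}^2$) sends $P$ into $\mathbb{R}\times[0,s]$. $\mathbb{M}_P$: set of metric graphs arising as skeletons (delete infinite rays, retract leaves, smooth 2-valent vertices) of smooth tropical plane curves with Newton polygon $P$, i.e. those defined by min-plus tropical polynomials with finite coefficients at all lattice points of $P$ inducing a regular unimodular triangulation of $P$. It is a finite union of polyhedral cones $\mathbb{M}_\Delta$ indexed by regular unimodular triangulations $\Delta$ of $P$, and $\dim\mathbb{M}_P$ is the maximum of their dimensions. *)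

(* Defs.v *)
From HB Require Import structures.
From mathcomp Require Import all_boot all_order all_algebra finmap.
From mathcomp Require Import boolp classical_sets functions cardinality.
From mathcomp Require Import reals topology normedtype convex.

Set Implicit Arguments.
Unset Strict Implicit.
Unset Printing Implicit Defensive.

Import Order.TTheory GRing.Theory Num.Theory.
Import numFieldNormedType.Exports.

Local Open Scope ring_scope.

(* Finite sets ({set _}, [set x | _]) are the default; sets of points of the
   plane (type set _) are written with %classic. *)

Definition intmx (R : realType) m n (a : 'M[int]_(m, n)) : 'M[R]_(m, n) :=
  map_mx intr a.

Definition convex_hull (R : realType) (S : set 'cV[R]_2) : set 'cV[R]_2 :=
  smallest (@convex_set R 'cV[R]_2) S.

(* The sets X used below are bounded; fset_set of an infinite set is empty. *)
Definition lattice_points (R : realType) (X : set 'cV[R]_2) :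
    {fset 'cV[int]_2} :=
  fset_set [set a : 'cV[int]_2 | X (intmx R a)]%classic.

Definition lattice_hull (R : realType) (S : {fset 'cV[int]_2}) :
    set 'cV[R]_2 :=
  convex_hull [set intmx R a | a in [set` S]]%classic.

Arguments lattice_hull : clear implicits.

Definition lattice_polygon (R : realType) (P : set 'cV[R]_2) : Prop :=
  exists S : {fset 'cV[int]_2}, S != fset0 /\ P = lattice_hull R S.

(* Topological interior in the plane; the interior polygon may be empty. *)
Definition interior_polygon (R : realType) (P : set 'cV[R]_2) :
    set 'cV[R]_2 :=
  lattice_hull R (lattice_points (interior P)).

Definition maximal_polygon (R : realType) (P : set 'cV[R]_2) : Prop :=
  forall Q : set 'cV[R]_2, lattice_polygon Q -> (P `<=` Q)%classic ->
    interior_polygon Q = interior_polygon P -> Q = P.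

Definition fits_in_strip (R : realType) (P : set 'cV[R]_2) (s : R) : Prop :=
  exists (A : 'M[int]_2) (b : 'cV[int]_2), A \in unitmx /\
    forall x, P x -> 0 <= (intmx R A *m x + intmx R b) 1 0 <= s.

Definition is_lattice_width (R : realType) (P : set 'cV[R]_2) (d : R) : Prop :=
  fits_in_strip P d /\ forall s, fits_in_strip P s -> d <= s.

(* A coefficient vector c : A -> R stands for the min-plus polynomial
   min_(a in A) (c a + <a, v>). *)
Definition trop_term (R : realType) (A : {fset 'cV[int]_2}) (c : A -> R)
    (v : 'cV[R]_2) (a : A) : R :=
  c a + \sum_i intmx R (val a) i 0 * v i 0.

(* The monomials attaining the minimum at v, i.e. the cell, dual to the cell of
   the tropical curve containing v, of the regular subdivision given by c. *)
Definition dual_cell (R : realType) (A : {fset 'cV[int]_2}) (c : A -> R)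
    (v : 'cV[R]_2) : {set A} :=
  [set a | [forall b, trop_term c v a <= trop_term c v b]].

Definition dual_subdivision (R : realType) (A : {fset 'cV[int]_2})
    (c : A -> R) : {set {set A}} :=
  [set T | maxset [pred U | `[< exists v, U = dual_cell c v >]] T].

Definition unimodular_triangle (A : {fset 'cV[int]_2}) (T : {set A}) : bool :=
  [exists p, exists q, exists r, (T == [set p; q; r]) &&
     (`|\det (row_mx (val q - val p) (val r - val p) : 'M_2)| == 1)].

(* D is the unimodular triangulation, given by its triangles, induced by c; the
   tropical curve of c is then smooth. *)
Definition induces_triangulation (R : realType) (A : {fset 'cV[int]_2})
    (c : A -> R) (D : {set {set A}}) : Prop :=
  dual_subdivision c = D /\ [forall T in D, unimodular_triangle T].

Definition regular_unimodular (R : realType) (A : {fset 'cV[int]_2})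
    (D : {set {set A}}) : Prop :=
  exists c : A -> R, induces_triangulation c D.

(* The graph of a smooth tropical curve, read off from its dual triangulation
   D: vertices are dual to the triangles T of D and edges to the edges e of D,
   T being an endpoint of e when e \subset T. The unbounded rays are dual to
   the edges of D lying in a single triangle, so discarding them leaves: *)
Definition bounded_edges (A : {fset 'cV[int]_2}) (D : {set {set A}}) :
    {set {set A}} :=
  [set e : {set A} | (#|e| == 2%N) && (#|[set T in D | e \subset T]| == 2%N)].

Definition valence (A : {fset 'cV[int]_2}) (F : {set {set A}}) (T : {set A}) :
    nat :=
  #|[set e in F | e \subset T]|.

Definition retract_leaves (A : {fset 'cV[int]_2}) (D F : {set {set A}}) :
    {set {set A}} :=
  [set e in F | [forall T in D, (e \subset T) ==> (valence F T != 1%N)]].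

(* Each retraction that is not idle removes an edge, so this is the stable
   outcome. *)
Definition core_edges (A : {fset 'cV[int]_2}) (D : {set {set A}}) :
    {set {set A}} :=
  iter #|bounded_edges D| (retract_leaves D) (bounded_edges D).

Definition share_2valent (A : {fset 'cV[int]_2}) (D : {set {set A}}) :
    rel {set A} :=
  fun e f => [&& e \in core_edges D, f \in core_edges D &
    [exists T in D, [&& e \subset T, f \subset T &
                        valence (core_edges D) T == 2%N]]].

(* Smoothing 2-valent vertices merges chains of edges: an edge of the skeleton
   is the set of the original edges that it is made of. *)
Definition skeleton_edges (A : {fset 'cV[int]_2}) (D : {set {set A}}) :
    {set {set {set A}}} :=
  equivalence_partition (connect (share_2valent D)) (core_edges D).

Definition curve_edge (R : realType) (A : {fset 'cV[int]_2}) (c : A -> R)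
    (e : {set A}) : set 'cV[R]_2 :=
  [set v | e \subset dual_cell c v]%classic.

Definition is_lattice_length (R : realType) (X : set 'cV[R]_2) (l : R) : Prop :=
  0 <= l /\ exists (p : 'cV[R]_2) (u : 'cV[int]_2),
    coprimez (u 0 0) (u 1 0) /\
    X = [set p + t *: intmx R u | t in [set t | 0 <= t <= l]]%classic.

(* Only used for segments of rational slope, which have a unique length. *)
Definition lattice_length (R : realType) (X : set 'cV[R]_2) : R :=
  xget 0 (is_lattice_length X : set R).

Definition skeleton_lengths (R : realType) (A : {fset 'cV[int]_2})
    (D : {set {set A}}) (c : A -> R) : 'rV[R]_#|skeleton_edges D| :=
  \row_i \sum_(e in (enum_val i : {set {set A}})) lattice_length (curve_edge c e).

(* The cone of the metric graphs arising from D, in the space of edge lengths of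
   their common underlying graph. *)
Definition moduli_cone (R : realType) (A : {fset 'cV[int]_2})
    (D : {set {set A}}) : set 'rV[R]_#|skeleton_edges D| :=
  [set skeleton_lengths D c | c in [set c | induces_triangulation c D]]%classic.

Arguments moduli_cone R {A} D.

(* The dimension of a cone is that of its linear span. *)
Definition cone_dim (R : realType) n (S : set 'rV[R]_n) : nat :=
  \max_(k < n.+1 |
      `[< exists M : 'M[R]_(k, n), row_free M /\ forall i, S (row i M) >]) k.

Definition moduli_dim (R : realType) (P : set 'cV[R]_2) : nat :=
  \max_(D : {set {set lattice_points P}} | `[< regular_unimodular R D >])
    cone_dim (moduli_cone R D).

(* Main.v *)
(** Fix a regular unimodular triangulation D of the set A of lattice points of
    P. On the cone of the coefficient vectors c inducing D, the skeleton edge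
    lengths are linear in c and vanish on affine functions of the lattice
    point, so dim M_D <= |A| - 3. In coordinates with P in the strip
    0 <= y <= d, suppose that one of the two sides of P joining y = 0 to y = d
    is a single segment with a lattice point in every row. The triangles of D
    on the edges of this side have apices in the adjacent lattice column, at
    monotone heights; by pigeonhole some lattice point of the side lies on at
    most two triangles, with a common apex, and its coefficient does not affect
    the skeleton. Each such side thus lowers the bound on the dimension by one.

    It remains to bound the number of non-interior lattice points of P, row by
    row. Up to the term 2g/(d-1), each side contributes at most the number of
    inner rows in which it has a lattice point, minus the average gap between
    it and its chord. If it has a lattice point in every row without being a
    segment, its abscissae form a convex nonlinear integer sequence, whose
    average gap is at least 1/2, which makes up for the missing side. *)
Require Import Defs.
From mathcomp Require Import all_boot all_order all_algebra finmap.
From mathcomp Require Import boolp classical_sets functions cardinality.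
From mathcomp Require Import reals topology normedtype convex interval_inference.
From mathcomp Require Import zify ring lra.
From mathcomp Require Import fintype finset.
Import Order.TTheory GRing.Theory Num.Theory.
Import numFieldNormedType.Exports.
Set Implicit Arguments.
Unset Strict Implicit.
Unset Printing Implicit Defensive.
Local Open Scope ring_scope.

(** * Argmin cells in planar coordinates *)

(** If the ends of all inner rows are lattice points on both sides, counting by rows gives at most
    [g + 2g/(d-1) + 2d + 2] lattice points. Removing 3 for the affine functions leaves [2d - 1] in
    place of the claimed [2d - 3], so one unit has to be saved on each side: in the count if the
    side misses a row or is not straight, in the rank if it is a straight column.

    The term [2g/(d-1)] comes from the two extreme rows. By convexity rows [i] and [d - i] are
    together at least as long as rows 0 and [d], and the lattice points strictly between the ends of
    the [d - 1] inner rows are interior.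

    The pigeonhole concerns [d] apices at heights from 0 to [d]. If the lowest is not at height 0
    and neighbours differ, the heights are forced to be 1, ..., [d], and the upper corner is flat.

    When both sides are columns, the two chosen points must be distinct and leave three noncollinear
    points. The danger is a corner common to both sides; hence a chosen corner comes with a
    neighbour in its own row. *)

Definition affval (R : realType) (A : finType) (X Y : A -> int) (c : A -> R)
    (x y : R) (a : A) : R :=
  c a + (X a)%:~R * x + (Y a)%:~R * y.

Definition argmin_set (R : realType) (A : finType) (h : A -> R) : {set A} :=
  [set a | [forall b, h a <= h b]].

Definition det3 (A : Type) (X Y : A -> int) (p q r : A) : int :=
  (X q - X p) * (Y r - Y p) - (X r - X p) * (Y q - Y p).

(** Phrasing the triangulation through two integer coordinates lets the arguments below run in any
    unimodular coordinates, and be reflected. *)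
Record planar_triangulation (R : realType) (A : finType) (X Y : A -> int)
    (c : A -> R) (D : {set {set A}}) : Prop := PlanarTriangulation {
  triangle_argmin : forall T, T \in D ->
    exists x y, T = argmin_set (affval X Y c x y);
  argmin_triangle : forall x y p q r,
    p \in argmin_set (affval X Y c x y) ->
    q \in argmin_set (affval X Y c x y) ->
    r \in argmin_set (affval X Y c x y) ->
    det3 X Y p q r != 0 -> argmin_set (affval X Y c x y) \in D;
  triangle_unimodular : forall T, T \in D ->
    exists p q r, T = [set p; q; r] /\ `|det3 X Y p q r| = 1
}.

Lemma argmin_setP (R : realType) (A : finType) (h : A -> R) a :
  reflect (forall b, h a <= h b) (a \in argmin_set h).
Proof. by rewrite inE; apply: forallP. Qed.

Lemma argmin_set_eq (R : realType) (A : finType) (h : A -> R) a b :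
  a \in argmin_set h -> b \in argmin_set h -> h a = h b.
Proof.
by move=> /argmin_setP ha /argmin_setP hb; apply/le_anti; rewrite ha hb.
Qed.

Lemma argmin_set_lt (R : realType) (A : finType) (h : A -> R) a b :
  a \in argmin_set h -> b \notin argmin_set h -> h a < h b.
Proof.
move=> ha; apply: contraNlt => hba; apply/argmin_setP => e.
by apply: le_trans hba _; move/argmin_setP: ha.
Qed.

(** The largest of the zeros [- h a / k a] serves as [x]. Geometrically, a point moves along an edge
    of the curve until one more monomial attains the minimum. *)
Lemma tighten (R : realType) (A : finType) (P : pred A) (h k : A -> R) :
  (forall a, P a -> 0 < k a) -> (exists a, P a) ->
  exists x a, [/\ P a, h a + k a * x = 0 & forall b, P b -> 0 <= h b + k b * x].
Proof.
move=> k0 [a0 Pa0]; pose z a := - h a / k a.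
have [a Pa amax] := @Order.TotalTheory.arg_maxP _ _ _ a0 P z Pa0.
exists (z a), a; split=> // [|b Pb].
  by rewrite /z mulrC divfK ?subrr // gt_eqF // k0.
have kb := k0 b Pb.
have zb : k b * z b = - h b by rewrite /z mulrC divfK // gt_eqF.
have -> : h b + k b * z a = k b * (z a - z b) by rewrite mulrBr zb opprK addrC.
by apply: mulr_ge0; [exact: ltW|rewrite subr_ge0; exact: amax].
Qed.

Lemma det3_xyx (A : Type) (X Y : A -> int) p q : det3 X Y p q p = 0.
Proof. by rewrite /det3; ring. Qed.

Lemma det3_xyy (A : Type) (X Y : A -> int) p q : det3 X Y p q q = 0.
Proof. by rewrite /det3; ring. Qed.

Lemma det3_basis (A : finType) (X Y : A -> int) (T : {set A}) p q r p' q' r' :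
  T = [set p'; q'; r'] -> `|det3 X Y p' q' r'| = 1 ->
  p \in T -> q \in T -> r \in T -> det3 X Y p q r != 0 ->
  T = [set p; q; r] /\ `|det3 X Y p q r| = 1.
Proof.
move=> -> det1; rewrite !inE -!orbA.
move=> /or3P[]/eqP-> /or3P[]/eqP-> /or3P[]/eqP-> det_neq0;
  try (by move: det_neq0; rewrite /det3; lia).
all: split; last by move: det1; rewrite /det3; lia.
all: by apply/setP => e; rewrite !inE; do !case: (_ == _).
Qed.

(** * Triangles along a lattice line bounding the polygon *)

(* A point of the line [X = 0] on at most two triangles of D, each with an edge
   on that line and all with the same apex; [e = e'] is allowed. *)
Definition flat_star (A : finType) (X : A -> int) (D : {set {set A}}) (a : A) :=
  exists q e e', [/\ X a = 0, X q = 1, X e = 0 /\ X e' = 0,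
    [/\ e != a, e' != a, [set a; e; q] \in D & [set a; e'; q] \in D] &
    forall T, T \in D -> a \in T -> T = [set a; e; q] \/ T = [set a; e'; q]].

Section Column.
Variables (R : realType) (A : finType) (X Y : A -> int) (c : A -> R).
Variables (D : {set {set A}}) (d : nat).
Hypothesis triD : planar_triangulation X Y c D.
Hypothesis XY_inj : forall a b, X a = X b -> Y a = Y b -> a = b.
Hypothesis X_ge0 : forall a, 0 <= X a.
Hypothesis Y_ge0 : forall a, 0 <= Y a.
Hypothesis Y_le : forall a, Y a <= d%:Z.
Hypothesis X_gt0 : exists a, 0 < X a.

(** For large [x] only the terms on the line [X = 0] compete. Lowering [x] until a term with
    [X q > 0] ties produces a cell with three noncollinear points; its determinant is
    [X q * (Y b - Y a)] up to sign, so unimodularity makes both factors units. *)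
Lemma ray_triangle y a b :
  X a = 0 -> X b = 0 -> a != b ->
  (forall e, X e = 0 -> c a + (Y a)%:~R * y <= c e + (Y e)%:~R * y) ->
  c b + (Y b)%:~R * y = c a + (Y a)%:~R * y ->
  exists x q, [/\ X q = 1, `|Y b - Y a| = 1,
    argmin_set (affval X Y c x y) = [set a; b; q] & [set a; b; q] \in D].
Proof.
move=> Xa Xb ab amin eq_ab.
pose h e := c e + (Y e)%:~R * y - (c a + (Y a)%:~R * y).
have [||x [q [Xq hq hmin]]] := @tighten R A (fun e => 0 < X e) h (fun e => (X e)%:~R).
- by move=> e Xe; rewrite ltr0z.
- exact: X_gt0.
have affE e : affval X Y c x y e = h e + (X e)%:~R * x + (c a + (Y a)%:~R * y).
  by rewrite /affval /h; ring.
have a_in : a \in argmin_set (affval X Y c x y).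
  apply/argmin_setP => e; rewrite !affE {1}/h Xa mulr0z mul0r subrr !add0r lerDr.
  have := X_ge0 e; rewrite le_eqVlt => /orP[/eqP/esym Xe|/hmin//].
  by rewrite Xe mulr0z mul0r addr0 subr_ge0 amin.
have in_of e : affval X Y c x y e = affval X Y c x y a ->
    e \in argmin_set (affval X Y c x y).
  by move=> ea; apply/argmin_setP => f; rewrite ea; move/argmin_setP: a_in.
have b_in : b \in argmin_set (affval X Y c x y).
  by apply: in_of; rewrite /affval Xa Xb; lra.
have q_in : q \in argmin_set (affval X Y c x y).
  by apply: in_of; rewrite !affE hq {1}/h Xa mulr0z mul0r subrr !add0r.
have Yab : Y b - Y a != 0.
  by apply: contraNneq ab => Yab; apply/eqP/XY_inj; lia.
have det_neq0 : det3 X Y a b q != 0.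
  rewrite /det3 Xa Xb subrr mul0r sub0r subr0 oppr_eq0 mulf_neq0 //.
  by rewrite gt_eqF.
have TD := argmin_triangle triD a_in b_in q_in det_neq0.
have [p' [q' [r' [Teq Tdet]]]] := triangle_unimodular triD TD.
have [TE det1] := det3_basis Teq Tdet a_in b_in q_in det_neq0.
have detE : `|det3 X Y a b q| = X q * `|Y b - Y a|.
  by rewrite /det3 Xa Xb subrr mul0r sub0r subr0 normrN normrM gtr0_norm.
have XYq : X q * `|Y b - Y a| = 1 by rewrite -detE.
have Yab_gt0 : 0 < `|Y b - Y a| by rewrite normr_gt0.
have [Xq1 Yab1] : X q = 1 /\ `|Y b - Y a| = 1 by nia.
by exists x, q; rewrite -TE.
Qed.

Variable p : nat -> A.
Hypothesis X_p : forall j, (j <= d)%N -> X (p j) = 0.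
Hypothesis Y_p : forall j, (j <= d)%N -> Y (p j) = j%:Z.

Lemma column_eq a : X a = 0 -> a = p `|Y a|%N.
Proof.
move=> Xa; have le_d : (`|Y a| <= d)%N by have := Y_ge0 a; have := Y_le a; lia.
by apply: XY_inj; rewrite ?X_p ?Y_p // gez0_abs.
Qed.

Lemma p_inj i j : (i <= d)%N -> (j <= d)%N -> (p i == p j) = (i == j).
Proof.
move=> id jd; apply/eqP/eqP => [/(congr1 Y)|-> //].
by rewrite !Y_p //; lia.
Qed.

(** The vertex of the curve at which the unbounded ray dual to the edge from [p j] to [p j.+1] ends;
    [q] is the apex of the triangle on that edge. *)
Definition ray_vertex j y x q :=
  [/\ X q = 1, argmin_set (affval X Y c x y) = [set p j; p j.+1; q] &
      [set p j; p j.+1; q] \in D].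

Lemma ray_vertex_step j y : (j < d)%N ->
  (forall i, (i < j)%N -> c (p j) + j%:R * y < c (p i) + i%:R * y) ->
  (forall i, (j < i <= d)%N -> c (p j) + j%:R * y <= c (p i) + i%:R * y) ->
  (exists2 i, (j < i <= d)%N & c (p j) + j%:R * y = c (p i) + i%:R * y) ->
  exists x q, ray_vertex j y x q.
Proof.
move=> jd below above [i /andP[ji id] eq_ij].
have YR k : (k <= d)%N -> (Y (p k))%:~R = k%:R :> R by move=> kd; rewrite Y_p // pmulrn.
have [|||e Xe||x [q [Xq Y1 argE TD]]] := @ray_triangle y (p j) (p i).
- by rewrite X_p // ltnW.
- by rewrite X_p.
- by rewrite p_inj ?(ltnW jd) // neq_ltn ji.
- rewrite (column_eq Xe); set k := `|Y e|%N.
  have kd : (k <= d)%N by have := Y_ge0 e; have := Y_le e; lia.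
  rewrite !YR ?(ltnW jd) //; case: (ltngtP k j) => [/below/ltW //|jk|-> //].
  by apply: above; rewrite jk.
- by rewrite !YR ?(ltnW jd).
have ij : i = j.+1 by move: Y1; rewrite !Y_p ?(ltnW jd) //; lia.
by rewrite ij in argE TD; exists x, q.
Qed.

Lemma ray_vertex_lt j y x q i : (j < d)%N -> (i <= d)%N -> ray_vertex j y x q ->
  i != j -> i != j.+1 -> c (p j) + j%:R * y < c (p i) + i%:R * y.
Proof.
move=> jd id [Xq argE _] ij ij1.
have := @argmin_set_lt _ _ (affval X Y c x y) (p j) (p i).
rewrite argE !inE eqxx !p_inj ?(ltnW jd) // (negPf ij) (negPf ij1) /=.
rewrite /affval !X_p ?(ltnW jd) // !Y_p ?(ltnW jd) // !mulr0z !mul0r !addr0 -!pmulrn.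
apply=> //; apply: contraTneq isT => piq.
by have := X_p id; rewrite piq Xq.
Qed.

Lemma ray_vertex_y j y x q : (j < d)%N -> ray_vertex j y x q ->
  y = c (p j) - c (p j.+1).
Proof.
move=> jd [_ argE _].
have := @argmin_set_eq _ _ (affval X Y c x y) (p j) (p j.+1).
rewrite argE !inE !eqxx orbT => /(_ isT isT).
rewrite /affval !X_p ?(ltnW jd) // !Y_p ?(ltnW jd) // !mulr0z !mul0r !addr0 -!pmulrn.
by rewrite -(natr1 j); lra.
Qed.

(** The heights [y] are the breakpoints of the piecewise linear function [min_i (c (p i) + i y)],
    met in decreasing order: the next one is the least [y] at which the term of [p j.+1] is still
    minimal. *)
Lemma ray_vertex_exists j : (j < d)%N -> exists y x q, ray_vertex j y x q.
Proof.
elim: j => [|j IHj] jd.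
  have [||y [i [iP eqi minP]]] := @tighten R 'I_d.+1 (fun i => (0 < i)%N)
    (fun i => c (p i) - c (p 0%N)) (fun i => (i : nat)%:R).
  - by move=> i; rewrite ltr0n.
  - by exists ord_max.
  exists y; apply: ray_vertex_step => // [k /andP[k0 kd]|].
    by have := minP (Ordinal (kd : (k < d.+1)%N)) k0; rewrite /=; lra.
  by exists i; [rewrite iP -ltnS ltn_ord|lra].
have [y0 [x0 [q0 rv]]] := IHj (ltnW jd).
have y0E := ray_vertex_y (ltnW jd) rv.
have [||y [i [iP eqi minP]]] := @tighten R 'I_d.+1 (fun i => (j.+1 < i)%N)
  (fun i => c (p i) - c (p j.+1)) (fun i => (i : nat)%:R - j.+1%:R).
- by move=> i; rewrite subr_gt0 ltr_nat.
- by exists ord_max.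
have id : (i <= d)%N by rewrite -ltnS ltn_ord.
have y_lt : y < y0.
  have := ray_vertex_lt (ltnW jd) id rv.
  rewrite !neq_ltn (ltnW iP) iP !orbT => /(_ isT isT).
  have : (j.+1)%:R < (i : nat)%:R :> R by rewrite ltr_nat.
  by move: eqi y0E; rewrite -(natr1 j); nra.
exists y; apply: ray_vertex_step => // [k kj|k /andP[k0 kd]|].
- have kd : (k <= d)%N by apply: leq_trans (ltnW jd); rewrite ltnW.
  have : c (p j.+1) + (j.+1)%:R * y0 <= c (p k) + k%:R * y0.
    have [->|kj'] := eqVneq k j; first by rewrite -(natr1 j); lra.
    have := ray_vertex_lt (ltnW jd) kd rv kj' _; rewrite neq_ltn kj => /(_ isT).
    by rewrite -(natr1 j); lra.
  have : k%:R < (j.+1)%:R :> R by rewrite ltr_nat.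
  by nra.
- by have := minP (Ordinal (kd : (k < d.+1)%N)) k0; rewrite /=; lra.
- by exists i; [rewrite iP id|lra].
Qed.

(** Add the minimality of [q] at [(x, y)] to that of [q'] at [(x', y')]. The coefficients cancel,
    and so do the abscissae because [X q = X q' = 1]; what remains is
    [(Y q' - Y q) * (y - y') >= 0]. *)
Lemma ray_vertex_le j y x q y' x' q' : (j.+1 < d)%N ->
  ray_vertex j y x q -> ray_vertex j.+1 y' x' q' -> y' < y /\ Y q <= Y q'.
Proof.
move=> jd rv rv'; have yE := ray_vertex_y (ltnW jd) rv.
have y'E := ray_vertex_y jd rv'.
have lt_y : y' < y.
  have := ray_vertex_lt (ltnW jd) jd rv; rewrite !neq_ltn !ltnS leqnn leqnSn !orbT.
  by move=> /(_ isT isT); rewrite -(natr1 j.+1) -(natr1 j); lra.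
split=> //; case: rv rv' => [Xq argE _] [Xq' argE' _].
have /argmin_setP/(_ q') : q \in argmin_set (affval X Y c x y) by rewrite argE !inE eqxx !orbT.
have /argmin_setP/(_ q) : q' \in argmin_set (affval X Y c x' y') by rewrite argE' !inE eqxx !orbT.
rewrite /affval Xq Xq' -(ler_int R); nra.
Qed.

Lemma ray_dichotomy : (0 < d)%N ->
  [\/ exists y x q, ray_vertex 0 y x q /\ Y q = 0,
      exists j y x y' x' q, [/\ (j.+1 < d)%N, ray_vertex j y x q & ray_vertex j.+1 y' x' q] |
      exists y x q, ray_vertex d.-1 y x q /\ Y q = d%:Z].
Proof.
move=> d_gt0.
(* The induction carries [j < Y q]: this holds at the start if the first apex is not at height 0,
   and persists while consecutive apices differ. At [j = d.-1] the bound [Y q <= d] turns it into an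
   equality. *)
suff H j : (j < d)%N ->
  [\/ exists y x q, ray_vertex 0 y x q /\ Y q = 0,
      exists j y x y' x' q, [/\ (j.+1 < d)%N, ray_vertex j y x q & ray_vertex j.+1 y' x' q] |
      exists y x q, ray_vertex j y x q /\ (j.+1%:Z <= Y q)].
  have ltd : (d.-1 < d)%N by rewrite prednK.
  case: (H _ ltd); [by constructor 1|by constructor 2|].
  move=> [y [x [q [rv le_d]]]]; constructor 3; exists y, x, q; split=> //.
  by apply/le_anti; rewrite Y_le -(prednK d_gt0).
elim: j => [_|j IHj jd].
  have [y [x [q rv]]] := ray_vertex_exists d_gt0.
  have [Yq|Yq] := eqVneq (Y q) 0; first by constructor 1; exists y, x, q.
  by constructor 3; exists y, x, q; split=> //; have := Y_ge0 q; lia.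
case: (IHj (ltnW jd)); [by constructor 1|by constructor 2|].
move=> [y [x [q [rv le_j]]]].
have [y' [x' [q' rv']]] := ray_vertex_exists jd.
have [_ Yqq'] := ray_vertex_le jd rv rv'.
have [eqY|neqY] := eqVneq (Y q) (Y q').
  constructor 2; exists j, y, x, y', x', q; split=> //.
  suff -> : q = q' by [].
  by apply: XY_inj => //; case: rv rv' => [-> _ _] [-> _ _].
by constructor 3; exists y', x', q'; split=> //; lia.
Qed.

Lemma corner_triangle T a q : T \in D -> a \in T -> X a = 0 -> X q = 1 ->
  (forall e, e \in T -> X e = 0 \/ e = q) ->
  exists e, [/\ X e = 0, `|Y e - Y a| = 1 & T = [set a; e; q]].
Proof.
move=> TD aT Xa Xq TX.
have [p1 [p2 [p3 [TE det1]]]] := triangle_unimodular triD TD.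
have [i1 i2 i3] : [/\ p1 \in T, p2 \in T & p3 \in T].
  by rewrite TE !inE !eqxx ?orbT.
have aq : a <> q by move=> aq; move: Xq; rewrite -aq Xa.
have qT : q \in T.
  apply: contra_eqT det1 => qT.
  have X0 e : e \in T -> X e = 0 by move=> eT; case: (TX e eT) => // eq; rewrite -eq eT in qT.
  by rewrite /det3 !X0 // !subrr !mul0r subrr normr0.
have [e TE' det_neq0] : exists2 e, T = [set a; e; q] & `|det3 X Y a e q| = 1.
  move: aT qT aq; rewrite {1 2}TE !inE -!orbA.
  move=> /or3P[]/eqP-> /or3P[]/eqP-> aq; try (by case: aq);
    [exists p3|exists p2|exists p3|exists p1|exists p2|exists p1];
    try (by move: det1; rewrite /det3; lia);
    by rewrite TE; apply/setP => f; rewrite !inE; do !case: (_ == _).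
exists e; have eT : e \in T by rewrite TE' !inE eqxx !orbT.
have eq : e <> q by move=> eq; move: det_neq0; rewrite /det3 eq; lia.
have Xe : X e = 0 by case: (TX e eT).
by split=> //; move: det_neq0; rewrite /det3 Xe Xa Xq; lia.
Qed.
Lemma affval_tie a b x y : X a = 0 -> X b = 1 ->
  b \in argmin_set (affval X Y c x y) -> a \in argmin_set (affval X Y c x y) ->
  x = c a + (Y a)%:~R * y - c b - (Y b)%:~R * y.
Proof.
move=> Xa Xb bM aM; have := argmin_set_eq aM bM.
by rewrite /affval Xa Xb; lra.
Qed.

(** Comparison with [p 1] and [q] confines the region where [p 0] is minimal to the quadrant above
    and to the right of [(x, y)]. Moving into this quadrant, no term can gain on [p 0], since [X]
    and [Y] are nonnegative; so the terms that lose at [(x, y)] stay out of [T]. *)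
Lemma corner_star y x q T : (0 < d)%N -> ray_vertex 0 y x q -> Y q = 0 ->
  T \in D -> p 0%N \in T -> T = [set p 0%N; p 1%N; q].
Proof.
move=> d_gt0 rv Yq TD pT; have yE := ray_vertex_y d_gt0 rv.
case: rv => [Xq argE _].
have [X0 Y0] := (X_p (leq0n d), Y_p (leq0n d)).
have [X1 Y1] := (X_p d_gt0, Y_p d_gt0).
have [x' [y' TE]] := triangle_argmin triD TD.
have p0M : p 0%N \in argmin_set (affval X Y c x' y') by rewrite -TE.
have /argmin_setP/(_ q) := p0M.
have /argmin_setP/(_ (p 1%N)) := p0M.
have xE : x = c (p 0%N) - c q.
  rewrite (@affval_tie (p 0%N) q x y) ?argE ?inE ?eqxx ?orbT //.
  by rewrite Y0 Yq; lra.
rewrite /affval X0 X1 Y0 Y1 Xq Yq => y_le x_le.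
have {}y_le : y <= y' by lra.
have {}x_le : x <= x' by lra.
have [e [Xe Ye ->]] : exists e, [/\ X e = 0, `|Y e - Y (p 0%N)| = 1 & T = [set p 0%N; e; q]].
  apply: (corner_triangle TD) => // e eT.
  have [|Xe] := eqVneq (X e) 0; [by left|right]; apply/eqP.
  apply: contraTT eT => eq; rewrite TE; apply/negP => eM.
  have := argmin_set_eq eM p0M.
  have := @argmin_set_lt _ _ (affval X Y c x y) (p 0%N) e.
  rewrite argE !inE eqxx (negPf eq) /= orbF => /(_ isT).
  case: eqP => [e0|_]; first by rewrite e0 X0 eqxx in Xe.
  case: eqP => [e1|_]; first by rewrite e1 X1 eqxx in Xe.
  move=> /(_ isT); rewrite /affval X0 Y0.
  have : 0 <= (X e)%:~R * (x' - x) by rewrite mulr_ge0 ?ler0z ?subr_ge0.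
  have : 0 <= (Y e)%:~R * (y' - y) by rewrite mulr_ge0 ?ler0z ?subr_ge0.
  by lra.
suff -> : e = p 1%N by [].
by apply: XY_inj; rewrite ?X1 //; have := Y_ge0 e; lia.
Qed.

(** The region where [p j.+1] is minimal lies at heights between [y'] and [y], to the right of the
    line on which [p j.+1] ties with [q]. A further term with [X e > 0] loses at both ends of this
    segment, hence along it, and no less to its right. *)
Lemma middle_star j y x y' x' q T : (j.+1 < d)%N ->
  ray_vertex j y x q -> ray_vertex j.+1 y' x' q -> T \in D -> p j.+1 \in T ->
  T = [set p j.+1; p j; q] \/ T = [set p j.+1; p j.+2; q].
Proof.
move=> jd rv rv' TD pT.
have [lt_y _] := ray_vertex_le jd rv rv'.
have yE := ray_vertex_y (ltnW jd) rv; have y'E := ray_vertex_y jd rv'.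
case: rv rv' => [Xq argE _] [_ argE' _].
have [X0 Y0] := (X_p (ltnW (ltnW jd)), Y_p (ltnW (ltnW jd))).
have [X1 Y1] := (X_p (ltnW jd), Y_p (ltnW jd)).
have [X2 Y2] := (X_p jd, Y_p jd).
have [x1 [y1 TE]] := triangle_argmin triD TD.
have pM : p j.+1 \in argmin_set (affval X Y c x1 y1) by rewrite -TE.
have /argmin_setP/(_ q) := pM.
have /argmin_setP/(_ (p j)) := pM.
have /argmin_setP/(_ (p j.+2)) := pM.
have xE : x = c (p j.+1) + (Y (p j.+1))%:~R * y - c q - (Y q)%:~R * y.
  by apply: affval_tie; rewrite ?argE ?inE ?eqxx ?orbT.
have x'E : x' = c (p j.+1) + (Y (p j.+1))%:~R * y' - c q - (Y q)%:~R * y'.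
  by apply: affval_tie; rewrite ?argE' ?inE ?eqxx ?orbT.
move: xE x'E; rewrite /affval X0 X1 X2 Xq Y0 Y1 Y2 -!pmulrn => xE x'E y1_ge y1_le x1_ge.
have {}y1_ge : y' <= y1 by move: y1_ge; rewrite y'E -(natr1 j.+1); lra.
have {}y1_le : y1 <= y by move: y1_le; rewrite yE -(natr1 j); lra.
have [e [Xe Ye ->]] : exists e, [/\ X e = 0, `|Y e - Y (p j.+1)| = 1 & T = [set p j.+1; e; q]].
  apply: (corner_triangle TD) => // e eT.
  have [|Xe] := eqVneq (X e) 0; [by left|right]; apply/eqP.
  apply: contraTT eT => eq; rewrite TE; apply/negP => eM.
  have := argmin_set_eq eM pM.
  have := @argmin_set_lt _ _ (affval X Y c x y) (p j.+1) e.
  have := @argmin_set_lt _ _ (affval X Y c x' y') (p j.+1) e.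
  rewrite argE argE' !inE eqxx (negPf eq) /= !orbT !orbF => /(_ isT) + /(_ isT).
  case: eqP => [e0|_]; first by rewrite e0 X1 eqxx in Xe.
  case: eqP => [e0|_]; first by rewrite e0 X2 eqxx in Xe.
  case: eqP => [e0|_]; first by rewrite e0 X0 eqxx in Xe.
  move=> /(_ isT) + /(_ isT); rewrite /affval X1 Y1 -!pmulrn => lt' lt1 eq1.
  have Xe_ge0 : (0 : R) <= (X e)%:~R by rewrite ler0z.
  (* [f z] is the excess of the term of [e] over that of [p j.+1] at height [z] on the line where
     [p j.+1] and [q] tie; it is affine in [z]. *)
  pose f z := c e + (X e)%:~R * (c (p j.+1) + j.+1%:R * z - c q - (Y q)%:~R * z)
    + (Y e)%:~R * z - c (p j.+1) - j.+1%:R * z.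
  have f_y : 0 < f y by rewrite /f -xE; lra.
  have f_y' : 0 < f y' by rewrite /f -x'E; lra.
  have : 0 < f y1.
    have -> : f y1 = ((y1 - y') * f y + (y - y1) * f y') / (y - y').
      by rewrite /f; field; lra.
    apply: divr_gt0; last by lra.
    move: (f y) (f y') f_y f_y' => u w u_gt0 w_gt0.
    have [y1_lt|y1_ge_y] := ltP y1 y.
      by apply: ltr_wpDl; [apply: mulr_ge0|apply: mulr_gt0]; lra.
    by apply: ltr_pwDl; [apply: mulr_gt0|apply: mulr_ge0]; lra.
  have : 0 <= (X e)%:~R * (x1 - (c (p j.+1) + j.+1%:R * y1 - c q - (Y q)%:~R * y1)).
    by apply: mulr_ge0 => //; lra.
  by rewrite /f; lra.
have [Ye2|Ye0] : Y e = j.+2 \/ Y e = j by lia.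
- by right; suff -> : e = p j.+2 by []; apply: XY_inj; rewrite ?X2 ?Y2.
- by left; suff -> : e = p j by []; apply: XY_inj; rewrite ?X0 ?Y0.
Qed.

Lemma column_point_bottom : (0 < d)%N ->
  (exists y x q, ray_vertex 0 y x q /\ Y q = 0) ->
  flat_star X D (p 0%N) /\ (exists2 q, X q = 1 & Y q = 0).
Proof.
move=> d_gt0 [y [x [q [rv Yq]]]]; case: (rv) => [Xq _ TD].
split; last by exists q.
exists q, (p 1%N), (p 1%N); rewrite !X_p // !p_inj //; split=> // T TD' pT.
by left; apply: corner_star rv _ TD' pT.
Qed.

Lemma column_point_middle :
  (exists j y x y' x' q,
    [/\ (j.+1 < d)%N, ray_vertex j y x q & ray_vertex j.+1 y' x' q]) ->
  exists2 j, (0 < j < d)%N & flat_star X D (p j).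
Proof.
move=> [j [y [x [y' [x' [q [jd rv rv']]]]]]].
case: (rv) (rv') => [Xq _ TD] [_ _ TD']; exists j.+1 => //.
have setC a b : [set a; b; q] = [set b; a; q] :> {set A}.
  by rewrite [[set a; b]]setUC.
exists q, (p j), (p j.+2).
rewrite !X_p ?(ltnW jd) ?(ltnW (ltnW jd)) // !p_inj ?(ltnW jd) ?(ltnW (ltnW jd)) //.
split=> //; first by rewrite setC; split=> //; rewrite neq_ltn ?leqnn ?orbT.
by move=> T TD1 pT; apply: middle_star rv rv' TD1 pT.
Qed.
End Column.

Lemma planar_triangulation_reflect (R : realType) (A : finType)
    (X Y : A -> int) (c : A -> R) (D : {set {set A}}) (k : int) :
  planar_triangulation X Y c D ->
  planar_triangulation X (fun a => k - Y a) c D.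
Proof.
move=> [D1 D2 D3].
have argE x y : argmin_set (affval X (fun a => k - Y a) c x y) =
                argmin_set (affval X Y c x (- y)).
  apply/setP => a; apply/argmin_setP/argmin_setP => amin b; have := amin b;
  by rewrite /affval !rmorphB /=; lra.
have detE a b e : det3 X (fun a => k - Y a) a b e = - det3 X Y a b e.
  by rewrite /det3; ring.
split.
- by move=> T /D1[x [y ->]]; exists x, (- y); rewrite argE opprK.
- move=> x y a b e; rewrite detE oppr_eq0 argE; exact: D2.
- by move=> T /D3[a [b [e [-> det1]]]]; exists a, b, e; rewrite detE normrN.
Qed.

(** The last alternative covers the corners: the row of a chosen corner contains a further lattice
    point. This keeps the points chosen on two opposite sides apart. *)
Lemma column_point (R : realType) (A : finType) (X Y : A -> int) (c : A -> R)
    (D : {set {set A}}) (d : nat) :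
  planar_triangulation X Y c D ->
  (forall a b, X a = X b -> Y a = Y b -> a = b) ->
  (forall a, 0 <= X a) -> (forall a, 0 <= Y a <= d%:Z) ->
  (exists a, 0 < X a) -> (0 < d)%N ->
  (forall j, (j <= d)%N -> exists2 a, X a = 0 & Y a = j%:Z) ->
  exists2 a, flat_star X D a &
    0 < Y a < d%:Z \/ exists2 q, X q = 1 & Y q = Y a.
Proof.
move=> triD XY_inj X_ge0 Y_bd X_gt0 d_gt0 pP.
have Y_ge0 a : 0 <= Y a by case/andP: (Y_bd a).
have Y_le a : Y a <= d%:Z by case/andP: (Y_bd a).
have [a0 _] := X_gt0.
have /choice[p pE] j : exists a, (j <= d)%N -> X a = 0 /\ Y a = j%:Z.
  case: (leqP j d) => [/pP[a Xa Ya]|_]; last by exists a0.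
  by exists a.
have X_p j : (j <= d)%N -> X (p j) = 0 by case/pE.
have Y_p j : (j <= d)%N -> Y (p j) = j%:Z by case/pE.
have [bot|mid|[y [x [q [rv Yq]]]]] :=
    ray_dichotomy triD XY_inj X_ge0 Y_ge0 Y_le X_gt0 X_p Y_p d_gt0.
- have [star [q Xq Yq]] := column_point_bottom triD XY_inj X_ge0 Y_ge0 X_p Y_p d_gt0 bot.
  by exists (p 0%N) => //; right; exists q; rewrite // Y_p.
- have [j /andP[j0 jd] star] := column_point_middle triD XY_inj X_ge0 X_p Y_p mid.
  by exists (p j) => //; left; rewrite Y_p ?(ltnW jd) //; lia.
(* The upper corner becomes the lower one under the reflection of [Y] in the strip. *)
- pose Y' a := d%:Z - Y a; pose p' j := p (d - j)%N.
  have XY'_inj a b : X a = X b -> Y' a = Y' b -> a = b.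
    by move=> Xab Yab; apply: XY_inj => //; rewrite /Y' in Yab; lia.
  have Y'_ge0 a : 0 <= Y' a by rewrite subr_ge0.
  have X_p' j : (j <= d)%N -> X (p' j) = 0 by move=> _; rewrite X_p ?leq_subr.
  have Y_p' j : (j <= d)%N -> Y' (p' j) = j%:Z.
    by move=> jd; rewrite /Y' Y_p ?leq_subr //; lia.
  have := column_point_bottom (planar_triangulation_reflect d triD) XY'_inj X_ge0 Y'_ge0 X_p' Y_p' d_gt0.
  case.
    exists (- y), x, q; case: rv => [Xq argE TD]; split; last by rewrite /Y' Yq subrr.
    have setC : [set p' 0%N; p' 1%N; q] = [set p d.-1; p d.-1.+1; q].
      by rewrite /p' subn0 subn1 prednK // [[set p d; _]]setUC.
    split; rewrite ?setC // -argE; apply/setP => a.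
    by apply/argmin_setP/argmin_setP => amin b; have := amin b;
      rewrite /affval !rmorphB /=; lra.
  rewrite /p' subn0 => star [q' Xq' Yq']; exists (p d) => //; right.
  by exists q' => //; rewrite Y_p //; rewrite /Y' in Yq'; lia.
Qed.

(** * The core of the dual graph *)

Lemma retract_leaves_sub (A : {fset 'cV[int]_2}) (D F : {set {set A}}) :
  retract_leaves D F \subset F.
Proof. by apply/subsetP => e; rewrite inE => /andP[]. Qed.

Lemma core_edges_bounded (A : {fset 'cV[int]_2}) (D : {set {set A}}) :
  core_edges D \subset bounded_edges D.
Proof.
rewrite /core_edges; elim: #|_| => //= n IHn.
exact: subset_trans (retract_leaves_sub _ _) IHn.
Qed.

Lemma core_edges_stable (A : {fset 'cV[int]_2}) (D : {set {set A}}) :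
  retract_leaves D (core_edges D) = core_edges D.
Proof.
rewrite /core_edges; set F := bounded_edges D.
pose it n := iter n (retract_leaves D) F.
have H n : retract_leaves D (it n) = it n \/ (#|it n| + n <= #|F|)%N.
  elim: n => [|n [IHn|IHn]]; first by right; rewrite addn0.
    by left; rewrite /it /= -/(it n) !IHn.
  have [eq|neq] := eqVneq (retract_leaves D (it n)) (it n).
    by left; rewrite /it /= -/(it n) !eq.
  right; apply: leq_trans IHn; rewrite addnS ltn_add2r.
  by apply: proper_card; rewrite properEneq neq retract_leaves_sub.
have [//|le_F] := H #|F|.
have /eqP it0 : it #|F| == set0 by rewrite -cards_eq0; lia.
rewrite -/(it _) it0; apply/eqP; rewrite -subset0.
exact: retract_leaves_sub.
Qed.

Lemma core_valence (A : {fset 'cV[int]_2}) (D : {set {set A}}) T :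
  T \in D -> valence (core_edges D) T != 1%N.
Proof.
move=> TD; apply/eqP => val1.
have /cards1P[e eE] : #|[set e in core_edges D | e \subset T]| == 1%N by apply/eqP.
have : e \in [set e in core_edges D | e \subset T] by rewrite eE inE.
rewrite inE => /andP[]; rewrite -{1}core_edges_stable inE => /andP[_].
by move=> /forall_inP/(_ T TD)/implyP + eT => /(_ eT); rewrite val1.
Qed.

Lemma skeleton_edge_core (A : {fset 'cV[int]_2}) (D : {set {set A}}) C :
  C \in skeleton_edges D -> C \subset core_edges D.
Proof. by case/imsetP => e _ ->; apply/subsetP => f; rewrite inE => /andP[]. Qed.

Lemma skeleton_edge_share (A : {fset 'cV[int]_2}) (D : {set {set A}}) C e f :
  C \in skeleton_edges D -> e \in C -> share_2valent D e f -> f \in C.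
Proof.
case/imsetP => e0 _ -> ; rewrite !inE => /andP[_ e0e] ef.
rewrite (connect_trans e0e (connect1 ef)) andbT.
by case/and3P: ef.
Qed.

Lemma share_2valentC (A : {fset 'cV[int]_2}) (D : {set {set A}}) e f :
  share_2valent D e f = share_2valent D f e.
Proof.
rewrite /share_2valent andbCA; congr [&& _, _ & _].
by apply: eq_existsb => T; rewrite (andbCA (e \subset T)).
Qed.

Lemma bounded_edge_eq (A : {fset 'cV[int]_2}) (D : {set {set A}}) e T1 T2 :
  e \in bounded_edges D ->
  (forall T, T \in D -> e \subset T -> T = T1 \/ T = T2) ->
  [/\ T1 != T2, T1 \in D, T2 \in D, e \subset T1 & e \subset T2].
Proof.
rewrite inE => /andP[_ /eqP card2] TP.
have sub : [set T in D | e \subset T] \subset [set T1; T2].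
  by apply/subsetP => T; rewrite !inE => /andP[/TP H /H[]->]; rewrite eqxx ?orbT.
have := subset_leq_card sub; rewrite card2 cards2.
case: eqVneq => //= neq _.
have /eqP E : [set T in D | e \subset T] == [set T1; T2].
  by rewrite eqEcard sub card2 cards2 neq.
have inD T : T \in [set T1; T2] -> (T \in D) && (e \subset T).
  by rewrite -E inE.
have /andP[D1 e1] := inD T1 (set21 _ _).
by have /andP[D2 e2] := inD T2 (set22 _ _).
Qed.

Lemma card2_sub3 (T : finType) (f : {set T}) x y z :
  x != y -> x != z -> y != z -> #|f| = 2%N -> f \subset [set x; y; z] ->
  [\/ f = [set x; y], f = [set x; z] | f = [set y; z]].
Proof.
move=> xy xz yz card_f fT.
have card3 : #|[set x; y; z]| = 3%N.
  by rewrite setUC cardsU1 cards2 !inE xy ![z == _]eq_sym (negPf xz) (negPf yz).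
have /cards1P[w wE] : #|[set x; y; z] :\: f| == 1%N.
  by rewrite cardsD (setIidPr fT) card3 card_f.
have fE : f = [set x; y; z] :\ w by rewrite -wE setDDr setDv set0U (setIidPr fT).
have : w \in [set x; y; z] :\: f by rewrite wE set11.
have [yx zx zy] : [/\ y != x, z != x & z != y] by split; rewrite eq_sym.
rewrite inE => /andP[_]; rewrite !inE -orbA => /or3P[]/eqP wE';
  [constructor 3|constructor 2|constructor 1]; rewrite fE wE'; apply/setP => u;
  rewrite !inE; case: eqVneq => [->|] //=; rewrite ?orbF //;
  by rewrite ?(negPf xy) ?(negPf xz) ?(negPf yz) ?(negPf yx) ?(negPf zx) ?(negPf zy).
Qed.

(** Without the edge from [a] to [b], the valence of the triangle in the core counts only its other
    two edges. It is not 1, so both are in the core or neither is. *)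
Lemma core_edge_triangle (A : {fset 'cV[int]_2}) (D : {set {set A}}) a b q :
  a != b -> a != q -> b != q -> [set a; b; q] \in D ->
  [set a; b] \notin core_edges D ->
  ([set a; q] \in core_edges D) = ([set b; q] \in core_edges D) /\
  ([set b; q] \in core_edges D -> share_2valent D [set a; q] [set b; q]).
Proof.
move=> ab aq bq TD abF; have := core_valence TD.
have sub2 c : c \in [set a; b] -> [set c; q] \subset [set a; b; q].
  by move=> cab; apply/subsetP => x; rewrite !inE => /orP[/eqP->|->];
     rewrite ?orbT //; move: cab; rewrite !inE => ->.
have sa := sub2 a (set21 _ _); have sb := sub2 b (set22 _ _).
have aqbq : [set a; q] != [set b; q].
  apply/eqP => /setP/(_ a); rewrite !inE eqxx (negPf aq) /= orbF.
  by rewrite (negPf ab).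
have valE : [set f in core_edges D | f \subset [set a; b; q]] =
            [set f in [set [set a; q]; [set b; q]] | f \in core_edges D].
  apply/setP => f; rewrite !inE andbC; case fF: (f \in core_edges D); rewrite ?andbF ?andbT //.
  have := subsetP (core_edges_bounded D) f fF; rewrite inE => /andP[/eqP card_f _].
  apply/idP/idP => [fT|/orP[]/eqP-> //].
  case: (card2_sub3 ab aq bq card_f fT) => fE; last 2 first.
  - by rewrite fE eqxx.
  - by rewrite fE eqxx orbT.
  - by rewrite -fE fF in abF.
rewrite /valence /share_2valent valE.
case aqF: ([set a; q] \in core_edges D); case bqF: ([set b; q] \in core_edges D) => //=.
- move=> _; split=> // _; apply/existsP; exists [set a; b; q].
  rewrite TD sa sb /valence valE /=.
  suff -> : [set f in [set [set a; q]; [set b; q]] | f \in core_edges D] = [set [set a; q]; [set b; q]].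
    by rewrite cards2 aqbq.
  by apply/setP => f; rewrite !inE; case: eqP => [->|_]; rewrite ?aqF //=;
     case: eqP => [->|_]; rewrite ?bqF.
- suff -> : [set f in [set [set a; q]; [set b; q]] | f \in core_edges D] = [set [set a; q]].
    by rewrite cards1.
  by apply/setP => f; rewrite !inE; case: eqP => [->|_]; rewrite ?aqF //=;
     case: eqP => [->|_]; rewrite ?bqF.
- suff -> : [set f in [set [set a; q]; [set b; q]] | f \in core_edges D] = [set [set b; q]].
    by rewrite cards1.
  apply/setP => f; rewrite !inE; case: (eqVneq f [set b; q]) => [->|_]; rewrite ?bqF ?orbT //=.
  by case: eqP => [->|_]; rewrite ?aqF.
Qed.

(* The edges {a, q}, {e, q} and {e', q} have coefficients -2, 1 and 1 at a, and
   lie on the same edge of the skeleton. *)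
Lemma flat_star_sum (R : realType) (A : {fset 'cV[int]_2}) (D : {set {set A}})
    (X : A -> int) (l : {set A} -> A -> R) (a : A) :
  (forall f, f \in bounded_edges D -> [/\
     forall b, b \notin f -> l f b = ((b |: f) \in D)%:R,
     \sum_b l f b = 0 & \sum_b l f b * (X b)%:~R = 0]) ->
  flat_star X D a ->
  forall C, C \in skeleton_edges D -> \sum_(f in C) l f a = 0.
Proof.
move=> lP [q [e [e' [Xa Xq [Xe Xe'] [ea e'a TD TD'] star]]]] C CD.
have qX b : X b = 0 -> b != q by move=> Xb; apply: contra_eqN Xb => /eqP->; rewrite Xq.
have [aq eq e'q] : [/\ a != q, e != q & e' != q] by rewrite !qX.
have ae : a != e by rewrite eq_sym ea.
have ae' : a != e' by rewrite eq_sym e'a.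
have core_sub f := subsetP (core_edges_bounded D) f.
have sub2 (x y z : A) : [set x; y] \subset [set x; y; z].
  by apply/subsetP => w; rewrite !inE => ->.
(* A bounded edge at [a] lies in two triangles, which must be the two of the star; so these differ
   and the edge is their common edge. *)
have bounded_at_a f : f \in bounded_edges D -> a \in f ->
    f = [set a; q] /\ e != e'.
  move=> fB af; have [TT' _ _ fT fT'] : [/\ [set a; e; q] != [set a; e'; q],
      [set a; e; q] \in D, [set a; e'; q] \in D, f \subset [set a; e; q] & f \subset [set a; e'; q]].
    by apply: bounded_edge_eq fB _ => T TD1 fT; apply: star => //; apply: (subsetP fT).
  have ee' : e != e' by apply: contraNneq TT' => ->.
  split=> //; move: fB; rewrite inE => /andP[/eqP card_f _].
  case: (card2_sub3 ae aq eq card_f fT) => fE //.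
    have : e \in [set a; e'; q] by apply: (subsetP fT'); rewrite fE set22.
    by rewrite !inE (negPf ea) (negPf ee') (negPf eq).
  by move: af; rewrite fE !inE (negPf ae) (negPf aq).
have ab_core b : X b = 0 -> [set a; b] \notin core_edges D.
  move=> Xb; apply: contraTN isT => /core_sub/bounded_at_a; rewrite set21 => /(_ isT)[E _].
  have : q \in [set a; b] by rewrite E set22.
  by rewrite !inE eq_sym (negPf aq) eq_sym (negPf (qX _ Xb)).
have [core1 share1] := core_edge_triangle ae aq eq TD (ab_core _ Xe).
have [core2 share2] := core_edge_triangle ae' aq e'q TD' (ab_core _ Xe').
have subC f : f \in C -> f \in core_edges D := subsetP (skeleton_edge_core CD) f.
have l_neq0 f : f \in C -> l f a != 0 ->
    [\/ f = [set a; q], f = [set e; q] | f = [set e'; q]].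
  move=> /subC/core_sub fB; have [af _|af] := boolP (a \in f).
    by constructor 1; case: (bounded_at_a f fB af).
  have [lE _ _] := lP f fB; rewrite lE //; case afD: (_ \in D); rewrite ?eqxx // => _.
  have fE : f = (a |: f) :\ a by rewrite setU1K.
  have [E|E] := star _ afD (setU11 _ _); [constructor 2|constructor 3].
  - rewrite fE E; apply/setP => x; rewrite !inE.
    by case: (eqVneq x a) => [->|] //=; rewrite (negPf ae) (negPf aq).
  - rewrite fE E; apply/setP => x; rewrite !inE.
    by case: (eqVneq x a) => [->|] //=; rewrite (negPf ae') (negPf aq).
(* The three edges are chained through the triangles of the star, so [C] contains all of them or
   none. *)
have [e0C|e0C] := boolP ([set a; q] \in C); last first.
  rewrite big1 // => f fC; apply/eqP; apply: contraNT e0C => /(l_neq0 f fC)[] fE.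
  - by rewrite -fE.
  - rewrite fE in fC; apply: (skeleton_edge_share CD fC).
    by rewrite share_2valentC share1 ?subC.
  - rewrite fE in fC; apply: (skeleton_edge_share CD fC).
    by rewrite share_2valentC share2 ?subC.
have e0core := subC _ e0C.
have e1C : [set e; q] \in C.
  by apply: (skeleton_edge_share CD e0C); rewrite share1 -?core1.
have e2C : [set e'; q] \in C.
  by apply: (skeleton_edge_share CD e0C); rewrite share2 -?core2.
have [_ ee'] := bounded_at_a _ (core_sub _ e0core) (set21 _ _).
have e'e : e' != e by rewrite eq_sym ee'.
have neq_q x y : x != y -> x != q -> [set x; q] != [set y; q].
  by move=> xy xq; apply/eqP => /setP/(_ x); rewrite !inE eqxx (negPf xy) (negPf xq).
have lE1 : l [set e; q] a = 1.
  have [lE _ _] := lP _ (core_sub _ (subC _ e1C)).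
  by rewrite lE ?setUA ?TD // !inE (negPf ae) (negPf aq).
have lE2 : l [set e'; q] a = 1.
  have [lE _ _] := lP _ (core_sub _ (subC _ e2C)).
  by rewrite lE ?setUA ?TD' // !inE (negPf ae') (negPf aq).
have lE0 : l [set a; q] a = - 2.
  have [lE l1 lX] := lP _ (core_sub _ e0core).
  have swap b : b |: [set a; q] = [set a; b; q] by rewrite setUCA setUA.
  have l_e : l [set a; q] e = 1.
    by rewrite lE ?swap ?TD // !inE (negPf ea) (negPf eq).
  have l_e' : l [set a; q] e' = 1.
    by rewrite lE ?swap ?TD' // !inE (negPf e'a) (negPf e'q).
  have l_0 b : b != a -> b != q -> b != e -> b != e' -> l [set a; q] b = 0.
    move=> ba bq be be'; rewrite lE; last by rewrite !inE (negPf ba) (negPf bq).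
    case bD: (_ \in D) => //.
    have [] := star _ bD; first by rewrite !inE eqxx orbT.
    - by move=> /setP/(_ b); rewrite !inE eqxx (negPf ba) (negPf bq) (negPf be).
    - by move=> /setP/(_ b); rewrite !inE eqxx (negPf ba) (negPf bq) (negPf be').
  (* Among the points whose coefficient may be nonzero, only [q] is off the line [X = 0], so the
     relation given by [X] yields its coefficient. The vanishing sum then leaves -2 at [a]. *)
  have l_q : l [set a; q] q = 0.
    move: lX; rewrite (bigD1 q) //= Xq mulr1 big1 ?addr0 // => b bq.
    have [->|ba] := eqVneq b a; first by rewrite Xa mulr0.
    have [->|be] := eqVneq b e; first by rewrite Xe mulr0.
    have [->|be'] := eqVneq b e'; first by rewrite Xe' mulr0.
    by rewrite (l_0 b ba bq be be') mul0r.
  have qa : q != a by rewrite eq_sym aq.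
  move: l1; rewrite (bigD1 a isT) (bigD1 q qa) (bigD1 e) /=; last by rewrite ea eq.
  rewrite (bigD1 e') /=; last by rewrite e'a e'q e'e.
  rewrite l_q l_e l_e' big1 => [|b /andP[/andP[/andP[ba bq] be] be']].
    by move: (l _ a); clear; move=> la; lra.
  exact: l_0 ba bq be be'.
rewrite (bigD1 [set a; q]) /=; last exact: e0C.
rewrite (bigD1 [set e; q]) ?e1C /=; last exact: neq_q ea eq.
rewrite (bigD1 [set e'; q]) ?e2C /=; last first.
  by rewrite (neq_q _ _ e'a e'q) (neq_q _ _ e'e e'q).
rewrite lE0 lE1 lE2 big1; first by clear; lra.
move=> f /andP[/andP[/andP[fC fa] fe] fe']; apply/eqP.
by apply: contraTT isT => /(l_neq0 _ fC)[] fE; rewrite fE eqxx in fa fe fe'.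
Qed.

(** * Unimodular coordinates *)

Definition coord0 (a : 'cV[int]_2) : int := a 0 0.
Definition coord1 (a : 'cV[int]_2) : int := a 1 0.

Definition unimodular_coords (X Y : 'cV[int]_2 -> int) : Prop :=
  exists m n s u v w : int, [/\ `|m * v - n * u| = 1,
    forall a, X a = m * coord0 a + n * coord1 a + s &
    forall a, Y a = u * coord0 a + v * coord1 a + w].

Lemma big_ord2 (V : nmodType) (F : 'I_2 -> V) : \sum_i F i = F 0 + F 1.
Proof.
by rewrite !big_ord_recl big_ord0 addr0; congr (_ + F _); apply: val_inj.
Qed.

Lemma det_mx2 (R : comNzRingType) (M : 'M[R]_2) :
  \det M = M 0 0 * M 1 1 - M 0 1 * M 1 0.
Proof.
rewrite (expand_det_row _ 0) big_ord2 /cofactor !det_mx11 !mxE /=.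
rewrite expr0 expr1 mul1r mulN1r mulrN.
by congr (M _ _ * M _ _ - M _ _ * M _ _); apply: val_inj.
Qed.

Lemma dual_cellE (R : realType) (A : {fset 'cV[int]_2}) (c : A -> R) v :
  dual_cell c v =
  argmin_set (affval (coord0 \o val) (coord1 \o val) c (v 0 0) (v 1 0)).
Proof.
have E a : trop_term c v a =
    affval (coord0 \o val) (coord1 \o val) c (v 0 0) (v 1 0) a.
  by rewrite /trop_term big_ord2 /intmx !mxE addrA.
apply/setP => a; apply/argmin_setP/argmin_setP => amin b; have := amin b;
by rewrite !E.
Qed.

Definition pt (K : Type) (x y : K) : 'cV[K]_2 := \col_i (if i == 0 then x else y).

Lemma pt0 (K : Type) (x y : K) : pt x y 0 0 = x.
Proof. by rewrite mxE. Qed.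

Lemma pt1 (K : Type) (x y : K) : pt x y 1 0 = y.
Proof. by rewrite mxE. Qed.

Lemma col2P (K : Type) (v w : 'cV[K]_2) :
  v 0 0 = w 0 0 -> v 1 0 = w 1 0 -> v = w.
Proof.
move=> e0 e1; apply/matrixP => i j; rewrite ord1.
case: i => [[|[|//]] lt_i]; first by rewrite (_ : Ordinal _ = 0) //; apply: val_inj.
by rewrite (_ : Ordinal _ = 1) //; apply: val_inj.
Qed.

Lemma argmin_pt (R : realType) (A : {fset 'cV[int]_2}) (c : A -> R) x y :
  argmin_set (affval (coord0 \o val) (coord1 \o val) c x y) =
  dual_cell c (pt x y).
Proof. by rewrite dual_cellE pt0 pt1. Qed.

(** Subtracting the ties at the two points gives a homogeneous linear system in [x - x'] and
    [y - y'] with determinant [det3 X Y p q r]. *)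
Lemma affval_inj (R : realType) (A : finType) (X Y : A -> int) (c : A -> R)
    p q r x y x' y' :
  det3 X Y p q r != 0 ->
  affval X Y c x y p = affval X Y c x y q ->
  affval X Y c x y p = affval X Y c x y r ->
  affval X Y c x' y' p = affval X Y c x' y' q ->
  affval X Y c x' y' p = affval X Y c x' y' r ->
  x = x' /\ y = y'.
Proof.
move=> det_neq0; rewrite /affval => e1 e2 e3 e4.
have detR : (det3 X Y p q r)%:~R != 0 :> R by rewrite intr_eq0.
have eq1 : ((X q)%:~R - (X p)%:~R) * (x - x') + ((Y q)%:~R - (Y p)%:~R) * (y - y') = 0 :> R.
  by lra.
have eq2 : ((X r)%:~R - (X p)%:~R) * (x - x') + ((Y r)%:~R - (Y p)%:~R) * (y - y') = 0 :> R.
  by lra.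
have detE : (det3 X Y p q r)%:~R =
  ((X q)%:~R - (X p)%:~R) * ((Y r)%:~R - (Y p)%:~R)
   - ((X r)%:~R - (X p)%:~R) * ((Y q)%:~R - (Y p)%:~R) :> R.
  by rewrite /det3 rmorphB !rmorphM !rmorphB.
rewrite detE in detR.
move: ((X q)%:~R - (X p)%:~R) ((Y r)%:~R - (Y p)%:~R) ((X r)%:~R - (X p)%:~R)
  ((Y q)%:~R - (Y p)%:~R) eq1 eq2 detR => {detE e1 e2 e3 e4} a b e f eq1 eq2 detR.
split; apply/eqP; rewrite -subr_eq0 -(mulrI_eq0 _ (mulfI detR)); apply/eqP.
- have -> : (a * b - e * f) * (x - x') = b * (a * (x - x') + f * (y - y')) - f * (e * (x - x') + b * (y - y')) by ring.
  by rewrite eq1 eq2 !mulr0 subrr.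
- have -> : (a * b - e * f) * (y - y') = a * (e * (x - x') + b * (y - y')) - e * (a * (x - x') + f * (y - y')) by ring.
  by rewrite eq1 eq2 !mulr0 subrr.
Qed.

Lemma planar_triangulation_std (R : realType) (A : {fset 'cV[int]_2})
    (c : A -> R) (D : {set {set A}}) :
  induces_triangulation c D ->
  planar_triangulation (coord0 \o val) (coord1 \o val) c D.
Proof.
move=> [DE /forall_inP unim]; split=> [T|x y p q r p_in q_in r_in det_neq0|T TD].
- rewrite -DE inE => /maxsetP[/asboolP[v ->] _].
  by exists (v 0 0), (v 1 0); rewrite dual_cellE.
- rewrite -DE inE; apply/maxsetP; split.
    by apply/asboolP; exists (pt x y); rewrite argmin_pt.
  (* A cell containing this one also contains [p], [q] and [r], whose ties determine the point of
     the plane; so it is the same cell. *)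
  move=> B /asboolP[v ->]; rewrite dual_cellE => /subsetP sub.
  have [p_in' q_in' r_in'] := And3 (sub _ p_in) (sub _ q_in) (sub _ r_in).
  have [-> -> //] := affval_inj det_neq0 (argmin_set_eq p_in' q_in')
    (argmin_set_eq p_in' r_in') (argmin_set_eq p_in q_in) (argmin_set_eq p_in r_in).
- have /existsP[p /existsP[q /existsP[r /andP[/eqP TE /eqP det1]]]] := unim T TD.
  exists p, q, r; split=> //; rewrite -det1 det_mx2.
  have E0 (a b : 'cV[int]_2) i : (row_mx a b : 'M_2) i 0 = a i 0.
    by rewrite -(row_mxEl a b i 0); congr (row_mx _ _ _ _); apply: val_inj.
  have E1 (a b : 'cV[int]_2) i : (row_mx a b : 'M_2) i 1 = b i 0.
    by rewrite -(row_mxEr a b i 0); congr (row_mx _ _ _ _); apply: val_inj.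
  by rewrite !E0 !E1 !mxE.
Qed.

Lemma det3_coordsE (A : {fset 'cV[int]_2}) X Y (m n s u v w : int) :
  (forall a, X a = m * coord0 a + n * coord1 a + s) ->
  (forall a, Y a = u * coord0 a + v * coord1 a + w) ->
  forall p q r : A, det3 (X \o val) (Y \o val) p q r =
    (m * v - n * u) * det3 (coord0 \o val) (coord1 \o val) p q r.
Proof. by move=> XE YE p q r; rewrite /det3 /= !XE !YE; ring. Qed.

(** The variables transform by the transposed matrix, while the translations [s] and [w] add the
    same amount to all terms. *)
Lemma planar_triangulation_coords (R : realType) (A : {fset 'cV[int]_2})
    (X Y : 'cV[int]_2 -> int) (c : A -> R) (D : {set {set A}}) :
  unimodular_coords X Y ->
  planar_triangulation (coord0 \o val) (coord1 \o val) c D ->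
  planar_triangulation (X \o val) (Y \o val) c D.
Proof.
move=> [m [n [s [u [v [w [det1 XE YE]]]]]]] [D1 D2 D3].
have argE (x y : R) : argmin_set (affval (X \o val) (Y \o val) c x y) =
    argmin_set (affval (coord0 \o val) (coord1 \o val) c
      (m%:~R * x + u%:~R * y) (n%:~R * x + v%:~R * y)).
  apply/setP => a; apply/argmin_setP/argmin_setP => amin b; have := amin b;
  by rewrite /affval /= !XE !YE !rmorphD !rmorphM /=; lra.
have detE := @det3_coordsE A X Y m n s u v w XE YE.
have eps2 : (m * v - n * u) * (m * v - n * u) = 1 by nia.
have det_neq0 : m * v - n * u != 0 by lia.
split=> [T /D1[x [y ->]]|x y p q r|T /D3[p [q [r [-> det3E]]]]].
- pose e : R := (m * v - n * u)%:~R.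
  exists (e * (v%:~R * x - u%:~R * y)), (e * (m%:~R * y - n%:~R * x)).
  rewrite argE.
  have ee : e * e = 1 by rewrite /e -rmorphM eps2.
  have eE : e = m%:~R * v%:~R - n%:~R * u%:~R by rewrite /e rmorphB !rmorphM.
  congr (argmin_set (affval _ _ _ _ _)).
  + transitivity (e * (m%:~R * v%:~R - n%:~R * u%:~R) * x); last by ring.
    by rewrite -eE ee mul1r.
  + transitivity (e * (m%:~R * v%:~R - n%:~R * u%:~R) * y); last by ring.
    by rewrite -eE ee mul1r.
- rewrite argE detE mulf_eq0 negb_or => pM qM rM /andP[_ det3_neq0].
  by apply: D2 pM qM rM det3_neq0.
- by exists p, q, r; split=> //; rewrite detE normrM det1 mul1r.
Qed.

(** * Lattice lengths of the edges of the curve *)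

(** Both parametrizations trace the same segment, so [l' *: u'] equals [(s1 - s0) *: u]. Pairing
    with Bezout coefficients of [u] gives [l' * k = s1 - s0] for an integer [k], nonzero unless
    [l' = 0]; hence [l' <= |s1 - s0| <= l]. *)
Lemma lattice_length_le (R : realType) (X : set 'cV[R]_2) (l l' : R) :
  is_lattice_length X l -> is_lattice_length X l' -> l' <= l.
Proof.
move=> [l_ge0 [p [u [/coprimezP[[a b] /= ab1] XE]]]].
move=> [l'_ge0 [p' [u' [cop' XE']]]].
have inX t : 0 <= t <= l' -> exists2 s, 0 <= s <= l & p' + t *: intmx R u' = p + s *: intmx R u.
  move=> t_bd; have : X (p' + t *: intmx R u') by rewrite XE'; exists t.
  by rewrite XE => -[s s_bd <-]; exists s.
have [|s0 /andP[s0_ge s0_le] eq0] := inX 0; first by rewrite lexx.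
have [|s1 /andP[s1_ge s1_le] eq1] := inX l'; first by rewrite l'_ge0 lexx.
have diff : l' *: intmx R u' = (s1 - s0) *: intmx R u.
  rewrite scale0r addr0 in eq0.
  rewrite scalerBl; apply: (addrI p'); rewrite eq1 eq0.
  by rewrite -addrA [s0 *: _ + _]addrC subrK.
have comp i : l' * (u' i 0)%:~R = (s1 - s0) * (u i 0)%:~R.
  by move/matrixP: diff => /(_ i 0); rewrite !mxE.
pose k := a * u' 0 0 + b * u' 1 0.
have kE : l' * k%:~R = s1 - s0.
  have ab1R : a%:~R * (u 0 0)%:~R + b%:~R * (u 1 0)%:~R = 1 :> R.
    by rewrite -!rmorphM -rmorphD ab1.
  rewrite /k rmorphD !rmorphM /=.
  transitivity (a%:~R * (l' * (u' 0 0)%:~R) + b%:~R * (l' * (u' 1 0)%:~R)).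
    by ring.
  rewrite !comp.
  transitivity ((s1 - s0) * (a%:~R * (u 0 0)%:~R + b%:~R * (u 1 0)%:~R)).
    by ring.
  by rewrite ab1R mulr1.
have [->|l'_neq0] := eqVneq l' 0; first by [].
have k_neq0 : k != 0.
  apply: contraTneq cop' => k0; rewrite k0 mulr0 in kE.
  have u'0 i : u' i 0 = 0.
    have := comp i; rewrite -kE mul0r => /eqP; rewrite mulf_eq0 (negPf l'_neq0).
    by rewrite intr_eq0 => /eqP.
  by rewrite /coprimez !u'0.
have : l' <= l' * `|k%:~R|.
  rewrite ler_peMr // -intr_norm -[1]/(1%:~R) ler_int.
  by rewrite -gtz0_ge1 normr_gt0.
have -> : l' * `|k%:~R| = `|s1 - s0| by rewrite -kE normrM ger0_norm.
move=> le_l'; apply: le_trans le_l' _; rewrite ler_norml; lra.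
Qed.

Lemma lattice_lengthE (R : realType) (X : set 'cV[R]_2) (l : R) :
  is_lattice_length X l -> lattice_length X = l.
Proof.
move=> Xl; apply: xget_unique => // l' Xl'.
by apply/le_anti; rewrite !(@lattice_length_le R X).
Qed.

Lemma unimodular_third (A : finType) (X Y : A -> int) (T : {set A}) a b e p q :
  T = [set a; b; e] -> `|det3 X Y a b e| = 1 -> p \in T -> q \in T -> p != q ->
  exists2 r, T = [set p; q; r] & `|det3 X Y p q r| = 1.
Proof.
move=> -> det1; rewrite !inE -!orbA.
move=> /or3P[]/eqP-> /or3P[]/eqP-> pq; try (by rewrite eqxx in pq);
  [exists e|exists b|exists e|exists a|exists b|exists a];
  try (by move: det1; rewrite /det3; lia);
  by apply/setP => f; rewrite !inE; do !case: (_ == _).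
Qed.

Lemma norm1_sqr (w : int) : `|w| = 1 -> w * w = 1.
Proof. by move=> w1; rewrite -expr2 -real_normK ?num_real // w1. Qed.

Lemma solve2 (K : fieldType) (a0 a1 r0 r1 dx dy t e : K) :
  e = a0 * r1 - r0 * a1 -> e * e = 1 -> a0 * dx + a1 * dy = 0 ->
  r0 * dx + r1 * dy = t -> dx = t * - (e * a1) /\ dy = t * (e * a0).
Proof.
move=> eE ee a_d r_d; split.
- transitivity (e * (r1 * (a0 * dx + a1 * dy) - a1 * (r0 * dx + r1 * dy))).
    by rewrite -[LHS]mul1r -ee eE; ring.
  by rewrite a_d r_d; ring.
- transitivity (e * (a0 * (r0 * dx + r1 * dy) - r0 * (a0 * dx + a1 * dy))).
    by rewrite -[LHS]mul1r -ee eE; ring.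
  by rewrite a_d r_d; ring.
Qed.

(* [p] and [q] span the common edge of two adjacent unimodular triangles; the
   affine relation between their four vertices reads r + s = 2 p + m (q - p). *)
Lemma curve_edge_length (R : realType) (A : {fset 'cV[int]_2}) (c : A -> R)
    (D : {set {set A}}) (p q r s : A) :
  let X := coord0 \o val in let Y := coord1 \o val in
  induces_triangulation c D ->
  [set p; q; r] \in D -> [set p; q; s] \in D ->
  `|det3 X Y p q r| = 1 -> `|det3 X Y p q s| = 1 ->
  r \notin [set p; q; s] -> s \notin [set p; q; r] ->
  det3 X Y p q s = - det3 X Y p q r /\
  (forall m : int, X s + X r = 2 * X p + m * (X q - X p) ->
   Y s + Y r = 2 * Y p + m * (Y q - Y p) ->
   lattice_length (curve_edge c [set p; q]) =
     c s + c r - 2 * c p - m%:~R * (c q - c p)).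
Proof.
move=> X Y indD rD sD det_r det_s rT sT.
have triD := planar_triangulation_std indD.
have [x1 [y1 T1]] := triangle_argmin triD rD.
have [x2 [y2 T2]] := triangle_argmin triD sD.
pose h x y (b : A) := affval X Y c x y b - affval X Y c x y p.
have p1 : p \in argmin_set (affval X Y c x1 y1) by rewrite -T1 !inE eqxx.
have p2 : p \in argmin_set (affval X Y c x2 y2) by rewrite -T2 !inE eqxx.
have tie x y b : p \in argmin_set (affval X Y c x y) ->
    b \in argmin_set (affval X Y c x y) -> h x y b = 0.
  by move=> pM bM; apply/eqP; rewrite subr_eq0 (argmin_set_eq bM pM).
have q1 : h x1 y1 q = 0 by apply: tie => //; rewrite -T1 !inE eqxx orbT.
have r1 : h x1 y1 r = 0 by apply: tie => //; rewrite -T1 !inE eqxx !orbT.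
have q2 : h x2 y2 q = 0 by apply: tie => //; rewrite -T2 !inE eqxx orbT.
have s2 : h x2 y2 s = 0 by apply: tie => //; rewrite -T2 !inE eqxx !orbT.
have r2 : 0 < h x2 y2 r.
  by rewrite subr_gt0; apply: argmin_set_lt => //; rewrite -T2.
have s1 : 0 < h x1 y1 s.
  by rewrite subr_gt0; apply: argmin_set_lt => //; rewrite -T1.
pose dX b : R := (X b - X p)%:~R; pose dY b : R := (Y b - Y p)%:~R.
have hE x y x' y' b : h x' y' b = h x y b + (dX b * (x' - x) + dY b * (y' - y)).
  by rewrite /h /affval /dX /dY !rmorphB /=; ring.
pose e : R := (det3 X Y p q r)%:~R.
have eE : e = dX q * dY r - dX r * dY q by rewrite /e /det3 rmorphB !rmorphM.
have ee : e * e = 1 by rewrite /e -rmorphM /= (norm1_sqr det_r).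
have det_sE : dX q * dY s - dX s * dY q = (det3 X Y p q s)%:~R.
  by rewrite /det3 rmorphB !rmorphM.
(* The excess of the term of [r] over that of [p] at the second vertex. It turns out to be the
   multiple of the primitive normal of [q - p] that leads from the first vertex to the second. *)
pose l := dX r * (x2 - x1) + dY r * (y2 - y1).
have l_gt0 : 0 < l by rewrite (hE x1 y1) r1 add0r in r2.
have q_d : dX q * (x2 - x1) + dY q * (y2 - y1) = 0.
  by rewrite (hE x1 y1) q1 add0r in q2.
have [dxE dyE] := solve2 eE ee q_d (erefl l).
(* From the first vertex to the second, the excess over [p] rises for [r] and falls for [s]; so [r]
   and [s] lie on opposite sides of the edge. *)
have det_opp : det3 X Y p q s = - det3 X Y p q r.
  have s_d : dX s * (x2 - x1) + dY s * (y2 - y1) < 0.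
    by move: s2; rewrite (hE x1 y1); lra.
  have : l * (e * (det3 X Y p q s)%:~R) < 0.
    by rewrite -det_sE; move: s_d; rewrite dxE dyE; lra.
  rewrite pmulr_rlt0 // /e -rmorphM /= ltrz0.
  move: (det3 X Y p q r) (det3 X Y p q s) det_r det_s => w w'; clear; nia.
have dsE : dX q * dY s - dX s * dY q = - e by rewrite det_sE det_opp rmorphN.
have s1E : h x1 y1 s = l.
  have := s2; rewrite (hE x1 y1) dxE dyE.
  have -> : dX s * (l * - (e * dY q)) + dY s * (l * (e * dX q)) =
            l * (e * (dX q * dY s - dX s * dY q)) by ring.
  by rewrite dsE mulrN ee; lra.
split=> // m Xm Ym; transitivity l; last first.
  have XR : dX s + dX r = m%:~R * dX q.
    by rewrite /dX -rmorphD -rmorphM /=; congr (_%:~R); clear -Xm; lia.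
  have YR : dY s + dY r = m%:~R * dY q.
    by rewrite /dY -rmorphD -rmorphM /=; congr (_%:~R); clear -Ym; lia.
  have hcE b : h x2 y2 b = c b - c p + (dX b * x2 + dY b * y2).
    by rewrite /h /affval /dX /dY !rmorphB /=; ring.
  have lE : l = h x2 y2 r by rewrite (hE x1 y1) r1 add0r.
  rewrite lE hcE; move: s2 q2; rewrite !hcE.
  have -> : dX r = m%:~R * dX q - dX s by rewrite -XR addrAC subrr add0r.
  have -> : dY r = m%:~R * dY q - dY s by rewrite -YR addrAC subrr add0r.
  move=> s2 q2.
  have : m%:~R * (c q - c p + (dX q * x2 + dY q * y2)) = 0 by rewrite q2 mulr0.
  by move: s2; lra.
apply: lattice_lengthE; split; first exact: ltW.
(* The direction is the normal of [q - p], oriented towards the second vertex. It is primitive: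
   [r - p] provides Bezout coefficients, as the determinant squares to 1. *)
exists (pt x1 y1), (pt (- (det3 X Y p q r * (Y q - Y p))) (det3 X Y p q r * (X q - X p))).
split.
  rewrite pt0 pt1; apply/coprimezP; exists (X r - X p, Y r - Y p) => /=.
  by rewrite -(norm1_sqr det_r) {3}/det3; ring.
have uE (t : R) : pt x1 y1 + t *: intmx R (pt (- (det3 X Y p q r * (Y q - Y p))) (det3 X Y p q r * (X q - X p))) =
    pt (x1 + t * - (e * dY q)) (y1 + t * (e * dX q)).
  by apply: col2P; rewrite !mxE /= ?rmorphN !rmorphM.
apply/seteqP; split=> [v|_ /= [t /andP[t_ge0 t_le] <-]].
- move=> pq; set x := v 0 0; set y := v 1 0.
  have [pM qM] : p \in argmin_set (affval X Y c x y) /\ q \in argmin_set (affval X Y c x y).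
    by rewrite -dual_cellE; split; apply: (subsetP pq); rewrite !inE eqxx ?orbT.
  have h_ge0 b : 0 <= h x y b by rewrite subr_ge0; move/argmin_setP: pM.
  have q_dv : dX q * (x - x1) + dY q * (y - y1) = 0.
    by have := tie _ _ _ pM qM; rewrite (hE x1 y1) q1 add0r.
  pose t := dX r * (x - x1) + dY r * (y - y1).
  have [dx dy] := solve2 eE ee q_dv (erefl t).
  exists t; last by rewrite uE -dx -dy; apply: col2P; rewrite ?pt0 ?pt1; rewrite addrC subrK.
  have := h_ge0 r; rewrite (hE x1 y1) r1 add0r -/t /= => ->.
  have := h_ge0 s; rewrite (hE x1 y1) s1E dx dy.
  have -> : dX s * (t * - (e * dY q)) + dY s * (t * (e * dX q)) =
            t * (e * (dX q * dY s - dX s * dY q)) by ring.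
  by rewrite dsE mulrN ee; lra.
- rewrite /curve_edge /= uE -argmin_pt -/X -/Y.
  set x := x1 + _; set y := y1 + _.
  have hxy b : h x y b = (1 - t / l) * h x1 y1 b + t / l * h x2 y2 b.
    rewrite (hE x1 y1 x y) (hE x1 y1 x2 y2) dxE dyE /x /y.
    by field; rewrite gt_eqF.
  have pM : p \in argmin_set (affval X Y c x y).
    apply/argmin_setP => b; rewrite -subr_ge0 -/(h x y b) hxy.
    have tl_ge0 : 0 <= t / l by rewrite divr_ge0 // ltW.
    have tl_le1 : t / l <= 1 by rewrite ler_pdivrMr // mul1r.
    apply: addr_ge0; apply: mulr_ge0 => //; rewrite subr_ge0 //.
    - by move/argmin_setP: p1.
    - by move/argmin_setP: p2.
  apply/subsetP => b; rewrite in_set2 => /orP[]/eqP-> //.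
  apply/argmin_setP => b'; rewrite -[_ q](subrK (affval X Y c x y p)) -/(h x y q).
  by rewrite hxy q1 q2 !mulr0 !add0r; move/argmin_setP: pM.
Qed.

(** * Rank of the edge length map *)

Lemma sum_delta (R : realType) (A : finType) (a : A) (f : A -> R) :
  \sum_b (b == a)%:R * f b = f a.
Proof.
rewrite (bigD1 a) //= eqxx mul1r big1 ?addr0 // => b /negPf->.
by rewrite mul0r.
Qed.

Lemma sum_delta4 (R : realType) (A : finType) (p q r s : A) (x y : R)
    (f : A -> R) :
  \sum_b ((b == r)%:R + (b == s)%:R + x * (b == p)%:R - y * (b == q)%:R) * f b =
  f r + f s + x * f p - y * f q.
Proof.
under eq_bigr => b _ do rewrite mulrBl !mulrDl -!mulrA.
by rewrite sumrB !big_split /= -!mulr_sumr !sum_delta.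
Qed.

(** Opposite determinants mean that [s + r - 2 p] is parallel to [q - p]. The factor [m] is a
    quotient of determinants against [r - p], and an integer because the divisor is a unit. *)
Lemma affine_relation (r0 r1 s0 s1 p0 p1 q0 q1 : int) :
  `|(q0 - p0) * (r1 - p1) - (r0 - p0) * (q1 - p1)| = 1 ->
  (q0 - p0) * (s1 - p1) - (s0 - p0) * (q1 - p1) =
    - ((q0 - p0) * (r1 - p1) - (r0 - p0) * (q1 - p1)) ->
  exists m : int, s0 + r0 = 2 * p0 + m * (q0 - p0) /\
            s1 + r1 = 2 * p1 + m * (q1 - p1).
Proof.
move=> /norm1_sqr; set d := _ - _ => dd ds.
pose z0 := s0 + r0 - 2 * p0; pose z1 := s1 + r1 - 2 * p1.
have zE : (q0 - p0) * z1 = z0 * (q1 - p1) by move: ds; rewrite /d /z0 /z1; lia.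
exists (d * (z0 * (r1 - p1) - z1 * (r0 - p0))); split.
- transitivity (2 * p0 + d * d * z0); first by rewrite dd /z0; ring.
  congr (_ + _); rewrite -!mulrA; congr (_ * _).
  transitivity (z0 * (q0 - p0) * (r1 - p1) - (r0 - p0) * (z0 * (q1 - p1))).
    by rewrite /d; ring.
  by rewrite -zE; ring.
- transitivity (2 * p1 + d * d * z1); first by rewrite dd /z1; ring.
  congr (_ + _); rewrite -!mulrA; congr (_ * _).
  transitivity ((q0 - p0) * z1 * (r1 - p1) - z1 * (r0 - p0) * (q1 - p1)).
    by rewrite /d; ring.
  by rewrite zE; ring.
Qed.

(** The length of the curve edge dual to [e] as a linear form in the coefficients. No value is
    prescribed at the ends of [e]; these follow from the three relations, which also express the
    invariance under adding affine functions to [c]. *)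
Record edge_functional (R : realType) (A : {fset 'cV[int]_2})
    (D : {set {set A}}) (e : {set A}) (l : A -> R) : Prop := EdgeFunctional {
  edge_functional_link : forall b, b \notin e -> l b = ((b |: e) \in D)%:R;
  edge_functional_sum : \sum_b l b = 0;
  edge_functional_coord0 : \sum_b l b * (coord0 (val b))%:~R = 0;
  edge_functional_coord1 : \sum_b l b * (coord1 (val b))%:~R = 0;
  edge_functional_length : forall c, induces_triangulation c D ->
    lattice_length (curve_edge c e) = \sum_b l b * c b
}.

Lemma edge_functional_exists (R : realType) (A : {fset 'cV[int]_2})
    (D : {set {set A}}) (e : {set A}) :
  regular_unimodular R D -> e \in bounded_edges D ->
  exists l : A -> R, edge_functional D e l.
Proof.
move=> [c0 ind0]; rewrite inE => /andP[/cards2P[p [q [pq ->]]]].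
move=> /cards2P[T1 [T2 [T12 TE]]].
have inD T : ((T \in D) && ([set p; q] \subset T)) = (T == T1) || (T == T2).
  by move/setP: TE => /(_ T); rewrite !inE.
have sub2 (a b : A) (T : {set A}) : [set a; b] \subset T -> a \in T /\ b \in T.
  by move=> sT; split; apply: (subsetP sT); rewrite !inE eqxx ?orbT.
have third T : T \in D -> [set p; q] \subset T -> exists2 r, T = [set p; q; r] &
    `|det3 (coord0 \o val) (coord1 \o val) p q r| = 1.
  move=> TD /sub2[pT qT].
  have [a [b [f [TabE det1]]]] := triangle_unimodular (planar_triangulation_std ind0) TD.
  exact: unimodular_third TabE det1 pT qT pq.
have := inD T1; rewrite eqxx => /andP[T1D T1pq].
have := inD T2; rewrite eqxx orbT => /andP[T2D T2pq].
have [r T1E det_r] := third T1 T1D T1pq; have [s T2E det_s] := third T2 T2D T2pq.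
have notin x y (T : {set A}) : T = [set p; q; x] -> T != [set p; q; y] ->
    `|det3 (coord0 \o val) (coord1 \o val) p q x| = 1 -> x \notin [set p; q; y].
  move=> TxE Ty det1; rewrite !inE -!orbA; apply/or3P => -[]/eqP xE.
  - by rewrite xE det3_xyx normr0 in det1.
  - by rewrite xE det3_xyy normr0 in det1.
  - by rewrite TxE xE eqxx in Ty.
have rT2 : r \notin [set p; q; s] by apply: notin T1E _ det_r; rewrite -T2E.
have sT1 : s \notin [set p; q; r].
  by apply: notin T2E _ det_s; rewrite -T1E eq_sym.
rewrite T1E in T1D; rewrite T2E in T2D.
have len (c : A -> R) : induces_triangulation c D -> _ :=
  fun indc => curve_edge_length indc T1D T2D det_r det_s rT2 sT1.
have [det_opp _] := len c0 ind0.
have [m [m0 m1]] : exists m : int,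
    coord0 (val s) + coord0 (val r) =
      2 * coord0 (val p) + m * (coord0 (val q) - coord0 (val p)) /\
    coord1 (val s) + coord1 (val r) =
      2 * coord1 (val p) + m * (coord1 (val q) - coord1 (val p)).
  exact: affine_relation det_r det_opp.
(* The coefficients of [c s + c r - 2 c p - m (c q - c p)]. They depend only on the four vertices,
   so the relation found with [c0] serves for every [c] inducing [D]. *)
pose l b : R := (b == r)%:R + (b == s)%:R + (m%:~R - 2) * (b == p)%:R
  - m%:~R * (b == q)%:R.
have sum_l := sum_delta4 p q r s (m%:~R - 2) m%:~R : forall f : A -> R, _.
exists l; split.
- move=> b; rewrite !inE negb_or => /andP[/negPf bp /negPf bq].
  have pq_sub : [set p; q] \subset b |: [set p; q] by apply: subsetUr.
  have -> : (b |: [set p; q] \in D) = (b == r) || (b == s).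
    have := inD (b |: [set p; q]); rewrite pq_sub andbT => ->.
    have setE x : (b |: [set p; q] == [set p; q; x]) = (b == x).
      apply/eqP/eqP => [|->]; last by rewrite setUC.
      by move=> /setP/(_ b); rewrite !inE eqxx bp bq => /esym/eqP.
    by rewrite T1E T2E !setE.
  rewrite /l bp bq !mulr0 subr0 addr0.
  have rs : r != s by apply: contraNneq rT2 => ->; rewrite !inE eqxx orbT.
  case: (eqVneq b r) => [->|]; first by rewrite (negPf rs) addr0.
  by rewrite add0r.
- transitivity (\sum_b l b * 1); first by apply: eq_bigr => b _; rewrite mulr1.
  by rewrite sum_l; ring.
- rewrite sum_l; move: m0 => /(congr1 (intr : int -> R)) /=.
  by rewrite !rmorphD !rmorphM !rmorphB /=; clear; lra.
- rewrite sum_l; move: m1 => /(congr1 (intr : int -> R)) /=.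
  by rewrite !rmorphD !rmorphM !rmorphB /=; clear; lra.
- move=> c /len[_ /(_ m m0 m1) ->]; rewrite sum_l; ring.
Qed.

Lemma edge_functional_coord (R : realType) (A : {fset 'cV[int]_2})
    (D : {set {set A}}) (e : {set A}) (l : A -> R) X Y :
  unimodular_coords X Y -> edge_functional D e l ->
  \sum_b l b * (X (val b))%:~R = 0.
Proof.
move=> [m [n [s [u [v [w [_ XE _]]]]]]] [_ l1 l_0 l_1 _].
transitivity (m%:~R * (\sum_b l b * (coord0 (val b))%:~R) +
  n%:~R * (\sum_b l b * (coord1 (val b))%:~R) + s%:~R * \sum_b l b).
  rewrite !mulr_sumr -!big_split /=; apply: eq_bigr => b _.
  by rewrite XE !rmorphD !rmorphM /=; ring.
by rewrite l1 l_0 l_1 !mulr0 !addr0.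
Qed.

Lemma cone_dim_le (R : realType) n (S : set 'rV[R]_n) (N : nat) :
  (forall k (M : 'M[R]_(k, n)), row_free M -> (forall i, S (row i M)) -> (k <= N)%N) ->
  (cone_dim S <= N)%N.
Proof.
move=> H; apply/bigmax_leqP => k /asboolP[M [Mfree MS]]; exact: H Mfree MS.
Qed.

Lemma skeleton_lengths_matrix (R : realType) (A : {fset 'cV[int]_2})
    (D : {set {set A}}) (l : {set A} -> A -> R) (c : A -> R) :
  (forall e, e \in bounded_edges D -> edge_functional D e (l e)) ->
  induces_triangulation c D ->
  skeleton_lengths D c = (\row_(a < #|{: A}|) c (enum_val a)) *m
    \matrix_(a < #|{: A}|, i < #|skeleton_edges D|)
      \sum_(e in (enum_val i : {set {set A}})) l e (enum_val a).
Proof.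
move=> lP indc; apply/rowP => i; rewrite !mxE.
under [RHS]eq_bigr => a _ do rewrite !mxE mulr_sumr.
rewrite exchange_big /=; apply: eq_bigr => e eC.
have eB : e \in bounded_edges D.
  apply: (subsetP (core_edges_bounded D)).
  by apply: (subsetP (skeleton_edge_core _)) eC; apply: enum_valP.
rewrite (edge_functional_length (lP e eB) indc).
rewrite (reindex (@enum_val A predT)) /=; last exact: onW_bij (@enum_val_bij A).
by apply: eq_bigr => a _; rewrite mulrC.
Qed.

(* The edge lengths are invariant under adding to c an affine function, and
   under changing c at the points of Q. *)
Lemma moduli_cone_dim_le (R : realType) (A : {fset 'cV[int]_2})
    (D : {set {set A}}) (Q : {set A}) :
  regular_unimodular R D ->
  (forall a, a \in Q -> exists X Y, unimodular_coords X Y /\ flat_star (X \o val) D a) ->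
  (exists p q r, [/\ p \notin Q, q \notin Q, r \notin Q &
    det3 (coord0 \o val) (coord1 \o val) p q r != 0]) ->
  (cone_dim (moduli_cone R D) + (3 + #|Q|) <= #|{: A}|)%N.
Proof.
move=> regD QP [p [q [r [pQ qQ rQ det_neq0]]]].
have /choice[l lP] e : exists l : A -> R, e \in bounded_edges D -> edge_functional D e l.
  have [eB|eB] := boolP (e \in bounded_edges D).
    by have [l le] := edge_functional_exists regD eB; exists l.
  by exists (fun=> 0).
pose L : 'M[R]_(#|{: A}|, #|skeleton_edges D|) :=
  \matrix_(a < #|{: A}|, i < #|skeleton_edges D|)
      \sum_(e in (enum_val i : {set {set A}})) l e (enum_val a).
(* The rows of [U] are the constant and the two coordinates, those of [V] the indicators of the
   points of [Q]. All are killed by [L], so their independence bounds the rank of [L], whose row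
   space contains the cone. *)
pose U : 'M[R]_(3, #|{: A}|) := \matrix_(i, a)
  if i == 0 then 1 else if i == 1 then (coord0 (val (enum_val a)))%:~R
  else (coord1 (val (enum_val a)))%:~R.
pose V : 'M[R]_(#|Q|, #|{: A}|) := \matrix_(i, a) (enum_val i == enum_val a)%:R.
have rowL (f : A -> R) i : (\sum_a f (enum_val a) * L a i) =
    \sum_(e in (enum_val i : {set {set A}})) \sum_b l e b * f b.
  under eq_bigr => a _ do rewrite !mxE mulr_sumr.
  rewrite exchange_big /=; apply: eq_bigr => e eC.
  rewrite [RHS](reindex (@enum_val A predT)) /=; last exact: onW_bij (@enum_val_bij A).
  by apply: eq_bigr => a _; rewrite mulrC.
have inB (i : 'I_#|skeleton_edges D|) e : e \in (enum_val i : {set {set A}}) -> e \in bounded_edges D.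
  move=> eC; apply: (subsetP (core_edges_bounded D)).
  by apply: (subsetP (skeleton_edge_core _)) eC; apply: enum_valP.
have UL : U *m L = 0.
  apply/matrixP => i j; rewrite [LHS]mxE [RHS]mxE.
  pose f (b : A) : R := if i == 0 then 1 else if i == 1 then (coord0 (val b))%:~R
    else (coord1 (val b))%:~R.
  transitivity (\sum_a f (enum_val a) * L a j).
    by apply: eq_bigr => a _; rewrite [U _ _]mxE.
  rewrite rowL big1 // => e /inB/lP[_ l1 l_0 l_1 _]; rewrite /f.
  case: (i == 0); first by under eq_bigr => b _ do rewrite mulr1.
  by case: (i == 1).
have VL : V *m L = 0.
  apply/matrixP => i j; rewrite [LHS]mxE [RHS]mxE.
  pose f (b : A) : R := (b == enum_val i)%:R.
  transitivity (\sum_a f (enum_val a) * L a j).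
    by apply: eq_bigr => a _; rewrite [V _ _]mxE eq_sym.
  rewrite rowL.
  have [X [Y [XY star]]] := QP _ (enum_valP i).
  transitivity (\sum_(e in (enum_val j : {set {set A}})) l e (enum_val i)).
    apply: eq_bigr => e _; rewrite -[RHS]sum_delta.
    by apply: eq_bigr => b _; rewrite mulrC.
  apply: (flat_star_sum _ star (enum_valP j)) => e /lP le; split.
  - exact: edge_functional_link le.
  - exact: edge_functional_sum le.
  - exact: edge_functional_coord XY le.
have freeK : row_free (col_mx U V).
  apply: inj_row_free => u uK.
  pose u1 := lsubmx u; pose u2 := rsubmx u.
  have uE : u1 *m U + u2 *m V = 0 by rewrite -mul_row_col hsubmxK.
  have u_at b : u1 0 0 + u1 0 1 * (coord0 (val b))%:~R +
      u1 0 ord_max * (coord1 (val b))%:~R + \sum_i u2 0 i * (enum_val i == b)%:R = 0.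
    have HV : (u2 *m V) 0 (enum_rank b) = \sum_i u2 0 i * (enum_val i == b)%:R.
      by rewrite mxE; apply: eq_bigr => i _; rewrite [V _ _]mxE enum_rankK.
    have HU : (u1 *m U) 0 (enum_rank b) = u1 0 0 +
        u1 0 1 * (coord0 (val b))%:~R + u1 0 ord_max * (coord1 (val b))%:~R.
      rewrite mxE !big_ord_recl big_ord0 ![U _ _]mxE /= enum_rankK mulr1 addr0 addrA.
      by congr (_ + u1 _ _ * _ + u1 _ _ * _); apply: val_inj.
    rewrite -HU -HV; have := congr1 (fun M : 'M_(_, _) => M 0 (enum_rank b)) uE.
    by rewrite /= [X in X = _]mxE => ->; rewrite mxE.
  have notQ b : b \notin Q -> \sum_i u2 0 i * (enum_val i == b)%:R = 0.
    move=> bQ; rewrite big1 // => i _; case: eqP => [E|_]; last by rewrite mulr0.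
    by rewrite -E enum_valP in bQ.
  (* Off [Q] the indicators vanish, and an affine function that is zero at three noncollinear points
     is zero. *)
  have u10 : u1 = 0.
    have u1_at b : b \notin Q -> u1 0 0 + u1 0 1 * (coord0 (val b))%:~R +
        u1 0 ord_max * (coord1 (val b))%:~R = 0.
      move=> bQ; apply: etrans (u_at b); apply/esym.
      exact: etrans (congr1 (+%R _) (notQ b bQ)) (addr0 _).
    have [hp hq hr] := And3 (u1_at p pQ) (u1_at q qQ) (u1_at r rQ).
    have [e1 e2] : u1 0 1 = 0 /\ u1 0 ord_max = 0.
      by apply: (affval_inj (c := fun=> u1 0 0) det_neq0);
        rewrite /affval /= ?mulr0 ?addr0 // ![_ * u1 _ _]mulrC ?hq ?hr hp.
    rewrite e1 e2 !mul0r !addr0 in hp.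
    apply/rowP => -[[|[|[|//]]] lt_i]; rewrite [RHS]mxE.
    - by rewrite -[RHS]hp; congr (u1 _ _); apply: val_inj.
    - by rewrite -[RHS]e1; congr (u1 _ _); apply: val_inj.
    - by rewrite -[RHS]e2; congr (u1 _ _); apply: val_inj.
  have u20 : u2 = 0.
    have z j : (0 : 'rV[R]_3) 0 j = 0 by rewrite mxE.
    apply/rowP => i; rewrite [RHS]mxE; have := u_at (enum_val i).
    rewrite u10 !z !mul0r !add0r (bigD1 i) //= eqxx mulr1 big1 ?addr0 //.
    by move=> j ji; rewrite (inj_eq enum_val_inj) (negPf ji) mulr0.
  by rewrite -[u]hsubmxK -/u1 -/u2 u10 u20 row_mx0.
rewrite addnC -leq_subRL; last first.
  by rewrite -(eqP freeK) rank_leq_col.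
apply: cone_dim_le => k M Mfree MS.
have ML : (M <= L)%MS.
  apply/row_subP => i; have [c /= indc <-] := MS i.
  by rewrite (skeleton_lengths_matrix lP indc) submxMl.
have := mulmx0_rank_max (_ : col_mx U V *m L = 0).
rewrite mul_col_mx UL VL col_mx0 => /(_ erefl).
rewrite (eqP freeK) => le_A; have := mxrankS ML; rewrite (eqP Mfree) => le_k.
by move: le_A le_k; clear; lia.
Qed.

(** * Rows of a convex planar region *)

(** The increments are monotone. If the first equals the last, the sequence is linear. Otherwise
    they differ by at least 1, so [F i + F (d - i)] drops by at least 1 from [i = 0] to [i = 1], and
    it does not rise again up to the middle. *)
Lemma convex_seq (F : nat -> int) (d : nat) : (1 < d)%N ->
  (forall i, (i.+1 < d)%N -> 2 * F i.+1 <= F i + F i.+2) ->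
  (exists s, forall i, (i <= d)%N -> F i = F 0%N + s * i%:Z) \/
  (forall i, (0 < i < d)%N -> F i + F (d - i)%N + 1 <= F 0%N + F d).
Proof.
move=> d_gt1 convF; pose D i := F i.+1 - F i.
have D_mono i j : (i <= j)%N -> (j < d)%N -> D i <= D j.
  elim: j => [|j IHj]; first by rewrite leqn0 => /eqP->.
  rewrite leq_eqVlt => /orP[/eqP-> //|ij] jd.
  by apply: le_trans (IHj ij (ltnW jd)) _; have := convF j jd; rewrite /D; lia.
have [eqD|neqD] := eqVneq (D 0%N) (D d.-1).
  left; exists (D 0%N); elim=> [|i IHi] id; first by rewrite mulr0 addr0.
  have Di : D i = D 0%N.
    apply/le_anti; rewrite (D_mono 0%N) // andbT eqD D_mono //; lia.
  by have := IHi (ltnW id); rewrite /D in Di *; lia.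
right; have D_lt : D 0%N + 1 <= D d.-1.
  by have := D_mono 0%N d.-1 (leq0n _) _; lia.
have low i : (0 < i)%N -> (i.*2 <= d)%N -> F i + F (d - i)%N + 1 <= F 0%N + F d.
  case: i => [//|i] _; elim: i => [_|i IHi id].
    by move: D_lt; rewrite /D prednK ?subn1; lia.
  have := IHi ltac:(lia); have := D_mono i.+1 (d - i.+2)%N.
  by rewrite /D (_ : (d - i.+2).+1 = (d - i.+1)%N); lia.
move=> i /andP[i0 id]; case: (leqP i.*2 d) => [|di]; first exact: low.
have := low (d - i)%N ltac:(lia) ltac:(lia); rewrite subKn; last exact: ltnW.
by rewrite [F (d - i)%N + _]addrC.
Qed.

(** A region is a relation between two coordinates, so that its right side is treated as a left side
    by substituting [- x]. *)
Definition convex_rel (R : realType) (Q : R -> R -> Prop) : Prop :=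
  forall x y x' y' t, Q x y -> Q x' y' -> 0 <= t <= 1 ->
    Q (t * x + (1 - t) * x') (t * y + (1 - t) * y').

Lemma sum_reflect (d : nat) (f : nat -> int) (K : int) :
  (forall i, (0 < i < d)%N -> f i + f (d - i)%N <= K) ->
  2 * \sum_(1 <= i < d) f i <= (d.-1)%:Z * K.
Proof.
move=> fK; have -> : 2 * \sum_(1 <= i < d) f i = \sum_(1 <= i < d) (f i + f (d - i)%N).
  rewrite big_split /= mulr2n mulrDl !mul1r; congr (_ + _).
  by rewrite big_nat_rev /=; apply: eq_big_nat => i _; rewrite add1n subSS.
have -> : d.-1%:Z * K = \sum_(1 <= i < d) K.
  by rewrite sumr_const_nat subn1 -mulr_natl natz.
by apply: ler_sum_nat => i; apply: fK.
Qed.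

(* [f i] is the floor of the left end of the row of height i, and [e i] tells
   whether that end is a lattice point. *)
Lemma side_bound (R : realType) (Q : R -> R -> Prop) (d : nat) (m0 md : int)
    (B : R) :
  convex_rel Q -> (forall x y, Q x y -> B <= x) -> (1 < d)%N ->
  Q m0%:~R 0 -> Q md%:~R d%:R ->
  (forall z : int, Q z%:~R 0 -> m0 <= z) ->
  (forall z : int, Q z%:~R d%:R -> md <= z) ->
  exists (f : nat -> int) (e : nat -> bool) (col : bool), [/\
    forall i, (0 < i < d)%N -> forall z : int, Q z%:~R i%:R ->
      f i <= z /\ (z = f i -> e i),
    forall i, (0 < i < d)%N -> forall z : int, f i < z ->
      exists2 x, Q x i%:R & x < z%:~R,
    (d.-1)%:Z * (\sum_(1 <= i < d) e i)%:Z + 2 * \sum_(1 <= i < d) f i <=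
      (d.-1)%:Z * (d%:Z - 2 + col%:Z + m0 + md) &
    col -> exists s, forall i, (i <= d)%N ->
      Q (m0 + s * i%:Z)%:~R i%:R /\
      forall z : int, Q z%:~R i%:R -> m0 + s * i%:Z <= z].
Proof.
move=> convQ QB d_gt1 Q0 Qd min0 mind.
have d_neq0 : d%:R != 0 :> R by rewrite pnatr_eq0; lia.
pose S i : set R := fun x => Q x i%:R.
pose chord (i : nat) : R := (1 - i%:R / d%:R) * m0%:~R + i%:R / d%:R * md%:~R.
have S_chord i : (i <= d)%N -> S i (chord i).
  move=> id; rewrite /S /chord addrC -[X in Q _ X](_ : i%:R / d%:R * d%:R + (1 - i%:R / d%:R) * 0 = _).
    apply: convQ => //; rewrite divr_ge0 ?ler0n //= ler_pdivrMr ?mul1r ?ler_nat //.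
    by rewrite lt_neqAle eq_sym d_neq0 ler0n.
  by rewrite mulr0 addr0 divfK.
have S_inf i : (i <= d)%N -> has_inf (S i).
  move=> id; split; first by exists (chord i); apply: S_chord.
  by exists B => x /QB.
(* Rounding down keeps [f] below the chord, and a lattice abscissa greater than [f i] still has
   points of the row strictly to its left. *)
pose f i : int := Num.floor (inf (S i)).
have f_le i x : (i <= d)%N -> Q x i%:R -> (f i)%:~R <= x.
  move=> id Qx; apply: le_trans (floor_le _) _.
  by apply: ge_inf => //; case: (S_inf i id).
pose e i := `[< Q (f i)%:~R i%:R /\ forall x, Q x i%:R -> (f i)%:~R <= x >].
have f_min i (z : int) : (i <= d)%N -> Q z%:~R i%:R -> f i <= z /\ (z = f i -> e i).
  move=> id Qz; split=> [|zE]; first by rewrite -(ler_int R) f_le.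
  by apply/asboolP; rewrite -zE; split=> // x Qx; rewrite zE f_le.
have f_lt i (z : int) : (i <= d)%N -> f i < z -> exists2 x, Q x i%:R & x < z%:~R.
  move=> id fz; apply: inf_lt; first by case: (S_inf i id).
  by rewrite -floor_lt_int.
have f_sum i : (0 < i < d)%N -> f i + f (d - i)%N <= m0 + md.
  move=> /andP[i0 id]; rewrite -(ler_int R) !rmorphD /=.
  have := f_le i _ (ltnW id) (S_chord i (ltnW id)).
  have := f_le (d - i)%N _ (leq_subr i d) (S_chord (d - i)%N (leq_subr i d)).
  have -> : chord (d - i)%N = i%:R / d%:R * m0%:~R + (1 - i%:R / d%:R) * md%:~R.
    have -> : chord (d - i)%N = (1 - (d - i)%:R / d%:R) * m0%:~R + (d - i)%:R / d%:R * md%:~R by [].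
    have -> : (d - i)%:R / d%:R = 1 - i%:R / d%:R :> R.
      by rewrite natrB ?(ltnW id) // mulrBl divff.
    by ring.
  by rewrite /chord; lra.
have sum_f := sum_reflect f_sum.
have sum_e : (\sum_(1 <= i < d) e i <= d.-1)%N.
  rewrite -[leqRHS]muln1 -subn1 -sum_nat_const_nat; apply: leq_sum => i _.
  by case: (e i).
have d1_gt0 : 0 <= d.-1%:Z by [].
have [all_e|/existsNP[i0 /not_implyP[i0d /negP ei0]]] :=
  pselect (forall i, (0 < i < d)%N -> e i); last first.
  (* The end of row [i0] is not a lattice point: the unit is saved in the sum of [e]. *)
  exists f, e, false; split=> [i /andP[_ /ltnW id] z|i /andP[_ /ltnW id] z||//].
  - exact: f_min.
  - exact: f_lt.
  have sum_e' : (\sum_(1 <= i < d) e i <= d - 2)%N.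
    have : (\sum_(1 <= i < d) e i + \sum_(1 <= i < d) ~~ e i = d.-1)%N.
      rewrite -big_split /= -[RHS]muln1 -subn1 -sum_nat_const_nat.
      by apply: eq_bigr => i _; case: (e i).
    have : (0 < \sum_(1 <= i < d) ~~ e i)%N.
      rewrite (bigD1_seq i0) ?iota_uniq //= ?(negPf ei0) //.
      by rewrite mem_index_iota.
    lia.
  have : d.-1%:Z * (\sum_(1 <= i < d) e i)%:Z <= d.-1%:Z * (d%:Z - 2).
    by apply: ler_wpM2l => //; lia.
  by move: sum_f; rewrite /=; lia.
(* All inner ends are now lattice points. In rows 0 and [d] the hypotheses provide the leftmost
   lattice points, which [F] takes there. *)
pose F i := if i == 0%N then m0 else if i == d then md else f i.
have FE i : (0 < i < d)%N -> F i = f i.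
  by rewrite /F => /andP[i_gt0 id]; rewrite gtn_eqF // ltn_eqF.
have F0 : F 0%N = m0 by [].
have Fd : F d = md by rewrite /F eqxx gtn_eqF // ltnW.
have F_Q i : (i <= d)%N -> Q (F i)%:~R i%:R.
  rewrite /F; case: eqVneq => [-> //|i0]; case: eqVneq => [-> //|id] le_id.
  by have /asboolP[] : e i by apply: all_e; rewrite lt0n i0 ltn_neqAle id.
(* The midpoint of the points chosen in rows [i] and [i.+2] lies in row [i.+1], hence not to the
   left of its end [F i.+1]. *)
have convF i : (i.+1 < d)%N -> 2 * F i.+1 <= F i + F i.+2.
  move=> id; have /all_e/asboolP[_ minf] : (0 < i.+1 < d)%N by [].
  have half : 0 <= (2 : R)^-1 <= 1.
    by rewrite invr_ge0 ler0n invf_le1 ?ltr0n ?ler1n.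
  have := convQ _ _ _ _ _ (F_Q i (ltnW (ltnW id))) (F_Q i.+2 id) half.
  rewrite -(natr1 i.+1) -(natr1 i).
  rewrite [X in Q _ X](_ : _ = i.+1%:R); last by rewrite -(natr1 i); field.
  move=> /minf fi; rewrite (FE i.+1) //.
  suff : f i.+1 + f i.+1 <= F i + F i.+2 by lia.
  by rewrite -(ler_int R) !rmorphD /=; lra.
have [[s lin]|kink] := convex_seq d_gt1 convF.
- exists f, e, true; split=> [i /andP[_ /ltnW id] z|i /andP[_ /ltnW id] z||_].
  + exact: f_min.
  + exact: f_lt.
  + have : d.-1%:Z * (\sum_(1 <= i < d) e i)%:Z <= d.-1%:Z * d.-1%:Z.
      by apply: ler_wpM2l => //; lia.
    have -> : d.-1%:Z * (d%:Z - 2 + true%:Z + m0 + md) =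
        d.-1%:Z * d.-1%:Z + d.-1%:Z * (m0 + md).
      by rewrite -mulrDr; congr (_ * _); lia.
    by move: sum_f; lia.
  + exists s => i id; rewrite -F0 -lin //; split; first exact: F_Q.
    move=> z; rewrite /F; case: eqVneq => [-> /min0 //|i0].
    by case: eqVneq => [-> /mind //|_] /(f_min i z id)[].
- exists f, e, false; split=> [i /andP[_ /ltnW id] z|i /andP[_ /ltnW id] z||//].
  + exact: f_min.
  + exact: f_lt.
  (* The gap of 1 in each pair of rows lowers the double sum by [d - 1], that is, by one unit after
     division by [d - 1]. *)
  + have {}sum_f : 2 * \sum_(1 <= i < d) f i <= d.-1%:Z * (m0 + md - 1).
      apply: sum_reflect => i i_bd; have := kink i i_bd.
      have i_bd' : (0 < d - i < d)%N by lia.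
      by rewrite (FE i) // (FE (d - i)%N) // F0 Fd; lia.
    have : d.-1%:Z * (\sum_(1 <= i < d) e i)%:Z <= d.-1%:Z * d.-1%:Z.
      by apply: ler_wpM2l => //; lia.
    have -> : d.-1%:Z * (d%:Z - 2 + false%:Z + m0 + md) =
        d.-1%:Z * d.-1%:Z + d.-1%:Z * (m0 + md - 1).
      by rewrite -mulrDr; congr (_ * _); lia.
    by lia.
Qed.

(** * Lattice polygons *)

Lemma lattice_polygon_convex (R : realType) (P : set 'cV[R]_2) x y t :
  lattice_polygon P -> P x -> P y -> 0 <= t <= 1 ->
  P (t *: x + (1 - t) *: y).
Proof.
move=> [S [_ ->]] Px Py /andP[t0 t1] C /= [convC SC].
have [xC yC] : x \in C /\ y \in C by split; apply: mem_set; [apply: Px|apply: Py].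
exact: set_mem (convC x y (Itv01 t0 t1) xC yC).
Qed.

Definition coordR (R : realType) (m n s : int) (x : 'cV[R]_2) : R :=
  m%:~R * x 0 0 + n%:~R * x 1 0 + s%:~R.

Lemma coordR_intmx (R : realType) m n s (a : 'cV[int]_2) :
  coordR m n s (intmx R a) = (m * coord0 a + n * coord1 a + s)%:~R.
Proof. by rewrite /coordR !mxE !rmorphD !rmorphM. Qed.

Lemma coordRD (R : realType) m n s (x y : 'cV[R]_2) t :
  coordR m n s (t *: x + (1 - t) *: y) =
  t * coordR m n s x + (1 - t) * coordR m n s y.
Proof. by rewrite /coordR !mxE; ring. Qed.

Lemma lattice_hull_ge (R : realType) (S : {fset 'cV[int]_2}) m n s (k : int) :
  (forall a, a \in S -> k <= m * coord0 a + n * coord1 a + s) ->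
  forall x, lattice_hull R S x -> k%:~R <= coordR m n s x.
Proof.
move=> Sk x Px; have := Px [set y | k%:~R <= coordR m n s y]%classic; apply.
split=> [y z t|_ /= [a aS <-]]; last by rewrite coordR_intmx ler_int Sk.
move=> /set_mem /= yk /set_mem /= zk; apply: mem_set; rewrite /= -[X in coordR _ _ _ X]/(t%:num *: (y : 'cV[R]_2) + (1 - t%:num) *: (z : 'cV[R]_2)).
rewrite coordRD; have t0 : 0 <= t%:num by []. have t1 : t%:num <= 1 by [].
have -> : k%:~R = t%:num * k%:~R + (1 - t%:num) * k%:~R :> R by ring.
by apply: lerD; apply: ler_wpM2l => //; rewrite subr_ge0.
Qed.

Lemma lattice_polygon_bounded (R : realType) (P : set 'cV[R]_2) m n s :
  lattice_polygon P -> exists N : nat, forall x, P x -> `|coordR m n s x| <= N%:R.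
Proof.
move=> [S [_ ->]].
pose h a : nat := absz (m * coord0 a + n * coord1 a + s).
pose N := (\sum_(a <- S) h a)%N; exists N => x Px.
have hN a : a \in S -> (h a <= N)%N.
  by move=> aS; rewrite /N (big_rem a) //= leq_addr.
rewrite ler_norml; apply/andP; split.
- have := @lattice_hull_ge R S m n s (- N%:Z) _ x Px.
  rewrite rmorphN /= -pmulrn; apply=> a aS.
  by have := hN a aS; rewrite /h; lia.
- have := @lattice_hull_ge R S (- m) (- n) (- s) (- N%:Z) _ x Px.
  have -> : coordR (- m) (- n) (- s) x = - coordR m n s x.
    by rewrite /coordR !rmorphN; ring.
  rewrite rmorphN /= -pmulrn lerN2; apply=> a aS.
  by have := hN a aS; rewrite /h; lia.
Qed.

Lemma pt_coords (a : 'cV[int]_2) : a = pt (coord0 a) (coord1 a).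
Proof. by apply: col2P; rewrite !mxE. Qed.

(** The polygon lies in a box with finitely many lattice points, so [fset_set] does not take its
    default value. *)
Lemma lattice_pointsP (R : realType) (P X : set 'cV[R]_2) a :
  lattice_polygon P -> (X `<=` P)%classic ->
  (a \in lattice_points X) = `[< X (intmx R a) >].
Proof.
move=> polP XP.
have [N0 b0] := lattice_polygon_bounded 1 0 0 polP.
have [N1 b1] := lattice_polygon_bounded 0 1 0 polP.
pose s := [seq pt (i%:Z - N0%:Z) (j%:Z - N1%:Z) |
  i <- iota 0 (N0 + N0).+1, j <- iota 0 (N1 + N1).+1].
rewrite /lattice_points in_fset_set.
  by apply/idP/asboolP => [/set_mem //|Xa]; apply: mem_set.
apply: (@sub_finite_set _ _ [set` s]) => [b /= /XP Pb|]; last exact: finite_seq.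
have := b0 _ Pb; rewrite coordR_intmx mul1r mul0r !addr0 -intr_norm pmulrn ler_int => c0.
have := b1 _ Pb; rewrite coordR_intmx mul1r mul0r add0r addr0 -intr_norm pmulrn ler_int => c1.
have -> : b = pt ((absz (coord0 b + N0%:Z))%:Z - N0%:Z)
                 ((absz (coord1 b + N1%:Z))%:Z - N1%:Z).
  by rewrite {1}(pt_coords b); congr pt; lia.
by apply: (allpairs_f (fun i j : nat => pt (i%:Z - N0%:Z) (j%:Z - N1%:Z)));
  rewrite mem_iota; lia.
Qed.

(** * Interior points of the inner rows *)

Lemma coordR_near (R : realType) (m n s : R) (v : 'cV[R]_2) :
  0 < m * v 0 0 + n * v 1 0 + s ->
  nbhs v [set w | 0 < m * w 0 0 + n * w 1 0 + s]%classic.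
Proof.
move=> v_gt0.
pose K := 1 + `|m| + `|n|.
have K_gt0 : 0 < K by rewrite /K; have := normr_ge0 m; have := normr_ge0 n; lra.
pose g (w : 'cV[R]_2) := m * w 0 0 + n * w 1 0 + s.
apply/nbhs_ballP; exists (g v / K) => [|w [_ vw]] /=; first exact: divr_gt0.
have near i : `|v i 0 - w i 0| < g v / K by have := vw i 0.
have gE : g v - g w = m * (v 0 0 - w 0 0) + n * (v 1 0 - w 1 0).
  by rewrite /g; ring.
have : g v - g w < g v.
  apply: le_lt_trans (ler_norm _) _; rewrite gE.
  apply: le_lt_trans (ler_normD _ _) _; rewrite !normrM.
  apply: (@le_lt_trans _ _ ((K - 1) * (g v / K))).
    have -> : (K - 1) * (g v / K) = `|m| * (g v / K) + `|n| * (g v / K).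
      by rewrite /K; ring.
    by apply: lerD; apply: ler_wpM2l => //; apply: ltW; exact: near.
  rewrite mulrBl mul1r mulrC divfK ?gt_eqF // gtrBl.
  exact: divr_gt0.
by rewrite gtrBl.
Qed.

Lemma convex_rel_mix (R : realType) (Q : R -> R -> Prop) x y x' y' a b X Y :
  convex_rel Q -> Q x y -> Q x' y' -> 0 <= a -> 0 <= b -> 0 < a + b ->
  (a + b) * X = a * x + b * x' -> (a + b) * Y = a * y + b * y' -> Q X Y.
Proof.
move=> convQ Qxy Qxy' a0 b0 ab XE YE.
have ab0 : a + b != 0 by rewrite gt_eqF.
have bE : 1 - a / (a + b) = b / (a + b) by field.
have -> : X = a / (a + b) * x + (1 - a / (a + b)) * x'.
  by rewrite bE; apply: (mulfI ab0); rewrite XE; field.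
have -> : Y = a / (a + b) * y + (1 - a / (a + b)) * y'.
  by rewrite bE; apply: (mulfI ab0); rewrite YE; field.
apply: convQ => //; rewrite divr_ge0 ?(ltW ab) //= ler_pdivrMr // mul1r lerDl //.
Qed.

(** The first two of the last four inequalities say that projecting [(x, y)] from [(t, d)] onto row
    [i] lands strictly between [x1] and [x2]; the other two say the same from [(b, 0)]. All are
    strict and linear in [x] and [y], so they define an open set. *)
Lemma convex_rel_quadrilateral (R : realType) (Q : R -> R -> Prop)
    (x1 x2 t b i d x y : R) :
  convex_rel Q -> Q x1 i -> Q x2 i -> Q t d -> Q b 0 -> 0 < i -> i < d ->
  0 < y -> y < d ->
  x1 * (d - y) < x * (d - i) - (y - i) * t ->
  x * (d - i) - (y - i) * t < x2 * (d - y) ->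
  x1 * y < x * i - (i - y) * b ->
  x * i - (i - y) * b < x2 * y -> Q x y.
Proof.
move=> convQ Q1 Q2 Qt Qb i0 id y0 yd up1 up2 lo1 lo2.
have Q_row z : x1 < z -> z < x2 -> Q z i.
  move=> z1 z2; apply: (convex_rel_mix (a := x2 - z) (b := z - x1) convQ Q1 Q2);
  by [lra|ring].
have [iy|yi] := leP i y.
- have dy : 0 < d - y by lra.
  have dy0 : d - y != 0 by rewrite gt_eqF.
  pose z := (x * (d - i) - (y - i) * t) / (d - y).
  have zE : (d - y) * z = x * (d - i) - (y - i) * t by rewrite mulrC divfK.
  have Qz : Q z i by apply: Q_row; rewrite ?ltr_pdivlMr ?ltr_pdivrMr.
  apply: (convex_rel_mix (a := d - y) (b := y - i) convQ Qz Qt); lra.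
- have y_neq0 : y != 0 by rewrite gt_eqF.
  pose z := (x * i - (i - y) * b) / y.
  have zE : y * z = x * i - (i - y) * b by rewrite mulrC divfK.
  have Qz : Q z i by apply: Q_row; rewrite ?ltr_pdivlMr ?ltr_pdivrMr.
  apply: (convex_rel_mix (a := y) (b := i - y) convQ Qz Qb); lra.
Qed.

Definition planar_rel (R : realType) (P : set 'cV[R]_2) (m n s u v w : int)
    (x y : R) : Prop :=
  exists2 z, P z & coordR m n s z = x /\ coordR u v w z = y.

Lemma planar_rel_convex (R : realType) (P : set 'cV[R]_2) m n s u v w :
  lattice_polygon P -> convex_rel (planar_rel P m n s u v w).
Proof.
move=> polP x y x' y' t [z Pz [<- <-]] [z' Pz' [<- <-]] t01.
exists (t *: z + (1 - t) *: z'); first exact: lattice_polygon_convex.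
by rewrite !coordRD.
Qed.

Lemma coordR_inj (R : realType) m n s u v w (z z' : 'cV[R]_2) :
  `|m * v - n * u| = 1 -> coordR m n s z = coordR m n s z' ->
  coordR u v w z = coordR u v w z' -> z = z'.
Proof.
move=> /norm1_sqr det1; rewrite /coordR => e1 e2.
pose e : R := (m * v - n * u)%:~R.
have ee : e * e = 1 by rewrite /e -rmorphM /= det1.
have eE : e = m%:~R * v%:~R - u%:~R * n%:~R.
  by rewrite /e rmorphB !rmorphM /= [n%:~R * _]mulrC.
have d1 : m%:~R * (z 0 0 - z' 0 0) + n%:~R * (z 1 0 - z' 1 0) = 0 by lra.
have d2 : u%:~R * (z 0 0 - z' 0 0) + v%:~R * (z 1 0 - z' 1 0) = 0 by lra.
have [z0 z1] := solve2 eE ee d1 d2.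
by apply: col2P; apply/eqP; rewrite -subr_eq0 ?z0 ?z1 mul0r.
Qed.

Lemma lattice_inverse (m n s u v w : int) : `|m * v - n * u| = 1 ->
  exists phi : int -> int -> 'cV[int]_2, forall z i,
    m * coord0 (phi z i) + n * coord1 (phi z i) + s = z /\
    u * coord0 (phi z i) + v * coord1 (phi z i) + w = i.
Proof.
move=> /norm1_sqr dd; pose e := m * v - n * u.
exists (fun z i => pt (e * (v * (z - s) - n * (i - w))) (e * (m * (i - w) - u * (z - s)))).
move=> z i; rewrite /coord0 /coord1 pt0 pt1; split.
- transitivity (e * e * (z - s) + s); first by rewrite {3}/e; ring.
  by rewrite dd; ring.
- transitivity (e * e * (i - w) + w); first by rewrite {3}/e; ring.
  by rewrite dd; ring.
Qed.

Lemma planar_rel_lattice (R : realType) (P : set 'cV[R]_2) (m n s u v w z i : int) :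
  `|m * v - n * u| = 1 -> planar_rel P m n s u v w z%:~R i%:~R ->
  exists2 a, P (intmx R a) & m * coord0 a + n * coord1 a + s = z /\
    u * coord0 a + v * coord1 a + w = i.
Proof.
move=> det1 [z' Pz' [zE iE]]; have [phi phiE] := lattice_inverse s w det1.
have [aX aY] := phiE z i; exists (phi z i) => //.
rewrite (_ : intmx R (phi z i) = z') //.
by apply: (@coordR_inj R m n s u v w) => //; rewrite coordR_intmx ?aX ?aY.
Qed.

Lemma interior_row (R : realType) (P : set 'cV[R]_2) (m n s u v w : int)
    (z : 'cV[R]_2) (d x1 x2 t b : R) :
  let Q := planar_rel P m n s u v w in
  lattice_polygon P -> `|m * v - n * u| = 1 ->
  0 < coordR u v w z < d -> Q x1 (coordR u v w z) -> Q x2 (coordR u v w z) ->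
  x1 < coordR m n s z < x2 -> Q t d -> Q b 0 -> interior P z.
Proof.
move=> Q polP det1; set X := coordR m n s z; set Y := coordR u v w z.
move=> /andP[Y0 Yd] Q1 Q2 /andP[X1 X2] Qt Qb.
have near (al be ga : R) : 0 < al * X + be * Y + ga ->
    nbhs z [set y | 0 < al * coordR m n s y + be * coordR u v w y + ga]%classic.
  have E y : al * coordR m n s y + be * coordR u v w y + ga =
      (al * m%:~R + be * u%:~R) * y 0 0 + (al * n%:~R + be * v%:~R) * y 1 0 +
      (al * s%:~R + be * w%:~R + ga) by rewrite /coordR; ring.
  rewrite E => /coordR_near; apply: filterS => y /=; by rewrite E.
(* The six strict conditions of [convex_rel_quadrilateral] for the row of [z], as open half-planes
   containing [z]. *)
have N1 := near 0 1 0 ltac:(lra).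
have N2 := near 0 (-1) d ltac:(lra).
have N3 := near (d - Y) (x1 - t) (Y * t - d * x1) ltac:(nra).
have N4 := near (- (d - Y)) (t - x2) (d * x2 - Y * t) ltac:(nra).
have N5 := near Y (b - x1) (- (Y * b)) ltac:(nra).
have N6 := near (- Y) (x2 - b) (Y * b) ltac:(nra).
apply: filterS (filterI (filterI (filterI N1 N2) (filterI N3 N4)) (filterI N5 N6)).
move=> y /= [[[h1 h2] [h3 h4]] [h5 h6]].
have [y' Py' [e1 e2]] : Q (coordR m n s y) (coordR u v w y).
  apply: (@convex_rel_quadrilateral R Q x1 x2 t b Y d) => //; try lra.
  exact: planar_rel_convex.
by rewrite -(coordR_inj det1 e1 e2).
Qed.

(** The second coordinate has integer extremes on the generators, and the strip between them
    contains [P]. By minimality it is the whole strip, so [d] is an integer and both boundary rows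
    contain lattice points. *)
Lemma lattice_width_strip (R : realType) (P : set 'cV[R]_2) (d : R) :
  lattice_polygon P -> is_lattice_width P d ->
  exists (m n s u v w : int) (k : nat), [/\ `|m * v - n * u| = 1, d = k%:R,
    forall x, P x -> 0 <= coordR u v w x <= k%:R,
    exists2 a, P (intmx R a) & u * coord0 a + v * coord1 a + w = 0 &
    exists2 a, P (intmx R a) & u * coord0 a + v * coord1 a + w = k%:Z].
Proof.
move=> [S [/fset0Pn[a0 a0S] PE]] [[M [b [Munit Mstrip]]] dmin].
have coordE (c : 'cV[int]_2) x :
    (intmx R M *m x + intmx R c) 1 0 = coordR (M 1 0) (M 1 1) (c 1 0) x.
  by rewrite !mxE big_ord2 !mxE.
have det1 : `|M 0 0 * M 1 1 - M 0 1 * M 1 0| = 1.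
  by move: Munit; rewrite unitmxE det_mx2 => /orP[]/eqP->.
pose Y a := M 1 0 * coord0 a + M 1 1 * coord1 a + b 1 0.
have SP a : a \in S -> P (intmx R a).
  by move=> aS; rewrite PE => C /= [_]; apply; exists a.
pose x0 : S := [` a0S]%fset.
have [amin _ minS] := @Order.TotalTheory.arg_minP _ _ _ x0 predT (fun a : S => Y (val a)) isT.
have [amax _ maxS] := @Order.TotalTheory.arg_maxP _ _ _ x0 predT (fun a : S => Y (val a)) isT.
have lowY : 0 <= Y (val amin).
  have := Mstrip _ (SP _ (valP amin)); rewrite coordE coordR_intmx => /andP[].
  by rewrite ler0z.
have upY : (Y (val amax))%:~R <= d.
  by have := Mstrip _ (SP _ (valP amax)); rewrite coordE coordR_intmx => /andP[].
have fits : fits_in_strip P (Y (val amax) - Y (val amin))%:~R.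
  exists M, (\col_i (b i 0 - Y (val amin))); split=> // x Px.
  rewrite coordE mxE.
  have Px' : lattice_hull R S x by rewrite -PE.
  have lo : (Y (val amin))%:~R <= coordR (M 1 0) (M 1 1) (b 1 0) x.
    by apply: lattice_hull_ge Px' => a aS; exact: (minS [` aS]%fset isT).
  have hi : (- Y (val amax))%:~R <= coordR (- M 1 0) (- M 1 1) (- b 1 0) x.
    apply: lattice_hull_ge Px' => a aS.
    by have : Y a <= Y (val amax) := maxS [` aS]%fset isT; rewrite /Y; lia.
  by move: lo hi; rewrite /coordR !rmorphB !rmorphN /=; lra.
have := dmin _ fits; rewrite rmorphB /= => d_le.
have Ymin0 : Y (val amin) = 0.
  by apply/le_anti; rewrite lowY andbT -(lerz0 R); lra.
rewrite Ymin0 subr0 in d_le.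
have dE : d = (Y (val amax))%:~R by apply/le_anti; rewrite d_le.
have Ymax : Y (val amax) = (absz (Y (val amax)))%:Z.
  by have : Y (val amin) <= Y (val amax) := maxS amin isT; lia.
exists (M 0 0), (M 0 1), 0, (M 1 0), (M 1 1), (b 1 0), (absz (Y (val amax))).
have dk : d = (absz (Y (val amax)))%:R by rewrite pmulrn -Ymax.
split=> // [x /Mstrip||].
- by rewrite coordE -dk.
- by exists (val amin) => //; apply: SP; apply: valP.
- by exists (val amax) => //; apply: SP; apply: valP.
Qed.

(** * Counting lattice points by rows *)

Lemma lattice_coords_inj (m n s u v w : int) (a b : 'cV[int]_2) :
  `|m * v - n * u| = 1 ->
  m * coord0 a + n * coord1 a + s = m * coord0 b + n * coord1 b + s ->
  u * coord0 a + v * coord1 a + w = u * coord0 b + v * coord1 b + w -> a = b.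
Proof.
move=> /norm1_sqr det1 e1 e2; pose e := m * v - n * u.
have E0 : coord0 a = coord0 b.
  transitivity (coord0 b + e * (v * (m * coord0 a + n * coord1 a + s - (m * coord0 b + n * coord1 b + s))
    - n * (u * coord0 a + v * coord1 a + w - (u * coord0 b + v * coord1 b + w)))).
    transitivity (coord0 b + e * e * (coord0 a - coord0 b)); first by rewrite det1; ring.
    by rewrite {2}/e; ring.
  by rewrite e1 e2; ring.
have E1 : coord1 a = coord1 b.
  transitivity (coord1 b + e * (m * (u * coord0 a + v * coord1 a + w - (u * coord0 b + v * coord1 b + w))
    - u * (m * coord0 a + n * coord1 a + s - (m * coord0 b + n * coord1 b + s)))).
    transitivity (coord1 b + e * e * (coord1 a - coord1 b)); first by rewrite det1; ring.
    by rewrite {2}/e; ring.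
  by rewrite e1 e2; ring.
by rewrite (pt_coords a) (pt_coords b) E0 E1.
Qed.

Section Counting.
Variables (R : realType) (P : set 'cV[R]_2) (m n s u v w : int) (k : nat).
Hypothesis polP : lattice_polygon P.
Hypothesis det1 : `|m * v - n * u| = 1.
Hypothesis strip : forall x, P x -> 0 <= coordR u v w x <= k%:R.
Let Q := planar_rel P m n s u v w.
Variables (f f' : nat -> int) (e e' : nat -> bool).
Hypothesis f_min : forall i, (0 < i < k)%N -> forall z : int, Q z%:~R i%:R ->
  f i <= z /\ (z = f i -> e i).
Hypothesis f'_min : forall i, (0 < i < k)%N -> forall z : int, Q (- z%:~R) i%:R ->
  f' i <= z /\ (z = f' i -> e' i).
Hypothesis f_lt : forall i, (0 < i < k)%N -> forall z : int, f i < z ->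
  exists2 x, Q x i%:R & x < z%:~R.
Hypothesis f'_lt : forall i, (0 < i < k)%N -> forall z : int, f' i < z ->
  exists2 x, Q (- x) i%:R & x < z%:~R.
Variables m0 M0 mk Mk : int.
Hypothesis row0 : forall z : int, Q z%:~R 0 -> m0 <= z <= M0.
Hypothesis rowk : forall z : int, Q z%:~R k%:R -> mk <= z <= Mk.
Hypothesis Q_m0 : Q m0%:~R 0.
Hypothesis Q_mk : Q mk%:~R k%:R.

Lemma interior_lattice_row (a : 'cV[int]_2) (i : nat) : (0 < i < k)%N ->
  u * coord0 a + v * coord1 a + w = i%:Z ->
  f i < m * coord0 a + n * coord1 a + s < - f' i ->
  interior P (intmx R a).
Proof.
move=> i_bd Ya /andP[Xa1 Xa2]; have /andP[i0 ik] := i_bd.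
have [x1 Q1 lt1] := f_lt i_bd Xa1.
have [x2 Q2 lt2] : exists2 x, Q (- x) i%:R & x < (- (m * coord0 a + n * coord1 a + s))%:~R.
  by apply: f'_lt => //; lia.
rewrite rmorphN /= in lt2.
apply: (@interior_row R P m n s u v w _ k%:R x1 (- x2) mk%:~R m0%:~R) => //.
- by rewrite coordR_intmx Ya -pmulrn ltr0n ltr_nat i0.
- by rewrite coordR_intmx Ya.
- by rewrite coordR_intmx Ya.
- by rewrite coordR_intmx lt1 /=; lra.
Qed.

Lemma interior_count :
  \sum_(1 <= i < k) (- f' i - f i - 1) <=
  (#|` lattice_points (interior P)|)%:Z.
Proof.
have [phi phiE] := lattice_inverse s w det1.
pose q i := - f' i - f i - 1.
(* [q i] may be negative, as for a row reduced to one lattice point, hence the truncation. *)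
pose N i := if 0 <= q i then absz (q i) else 0%N.
have qN i : q i <= (N i)%:Z by rewrite /N; case: ifP; lia.
apply: le_trans (_ : _ <= (\sum_(1 <= i < k) N i)%N%:Z) _.
  by rewrite (big_morph Posz PoszD (erefl _)); apply: ler_sum => i _; apply: qN.
rewrite lez_nat.
pose L := [seq phi (f i + 1 + j%:Z) i%:Z | i <- index_iota 1 k, j <- iota 0 (N i)].
have sizeL : size L = (\sum_(1 <= i < k) N i)%N.
  rewrite size_allpairs_dep sumnE big_map; apply: eq_bigr => i _.
  by rewrite size_iota.
rewrite -sizeL; apply: uniq_leq_size.
  apply: allpairs_uniq_dep => [|i _|]; rewrite ?iota_uniq //.
  move=> [i1 j1] [i2 j2] _ _ /= E.
  have [X1 Y1] := phiE (f i1 + 1 + j1%:Z) i1%:Z.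
  have [X2 Y2] := phiE (f i2 + 1 + j2%:Z) i2%:Z.
  have ii : i1 = i2 by move: Y1; rewrite E Y2 => -[].
  rewrite ii in X1 E *.
  by have -> : j1 = j2 by move: X1; rewrite E X2; lia.
move=> a /allpairsPdep[i [j]]; rewrite mem_index_iota mem_iota add0n => -[i_bd j_bd ->].
rewrite (lattice_pointsP _ polP); last exact: interior_subset.
apply/asboolP; have [Xphi Yphi] := phiE (f i + 1 + j%:Z) i%:Z.
apply: (interior_lattice_row i_bd Yphi); rewrite Xphi.
by move: j_bd; rewrite /N /q; case: ifP; lia.
Qed.

(** A lattice point of an inner row is interior unless it sits at [f i] or [- f' i], where [e i] or
    [e' i] counts it. *)
Lemma lattice_count : m0 <= M0 -> mk <= Mk ->
  (#|` lattice_points P|)%:Z <=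
  (#|` lattice_points (interior P)|)%:Z + (M0 - m0 + 1) + (Mk - mk + 1) +
  (\sum_(1 <= i < k) e i + \sum_(1 <= i < k) e' i)%N%:Z.
Proof.
move=> le0 lek; have [phi phiE] := lattice_inverse s w det1.
pose L0 := [seq phi (m0 + j%:Z) 0 | j <- iota 0 (absz (M0 - m0 + 1))].
pose Lk := [seq phi (mk + j%:Z) k%:Z | j <- iota 0 (absz (Mk - mk + 1))].
pose L1 := [seq phi (f i) i%:Z | i <- index_iota 1 k & e i].
pose L2 := [seq phi (- f' i) i%:Z | i <- index_iota 1 k & e' i].
have sizeF (b : nat -> bool) : size [seq i <- index_iota 1 k | b i] = (\sum_(1 <= i < k) b i)%N.
  by rewrite size_filter -sum1_count big_mkcond /=; apply: eq_bigr => i _; case: (b i).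
have : (#|` lattice_points P| <= size ((lattice_points (interior P) : seq _) ++ L0 ++ Lk ++ L1 ++ L2))%N.
  apply: uniq_leq_size => [|a]; first exact: fset_uniq.
  rewrite (lattice_pointsP _ polP) // => /asboolP Pa.
  pose X := m * coord0 a + n * coord1 a + s.
  pose Y := u * coord0 a + v * coord1 a + w.
  have aE : a = phi X Y.
    have [X1 Y1] := phiE X Y.
    by apply: (@lattice_coords_inj m n s u v w _ _ det1); [rewrite X1|rewrite Y1].
  have := strip Pa; rewrite coordR_intmx ler0z -/Y pmulrn ler_int => /andP[Y0 Yk].
  have Qa : Q X%:~R Y%:~R by exists (intmx R a) => //; rewrite !coordR_intmx.
  rewrite !mem_cat.
  have [Y_0|Yn0] := eqVneq Y 0.
    have /row0 : Q X%:~R 0 by rewrite -[0]/(0%:~R) -Y_0.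
    move=> /andP[mX XM]; apply/orP; right; apply/orP; left.
    apply/mapP; exists (absz (X - m0)); first by rewrite mem_iota; lia.
    by rewrite aE Y_0; congr phi; lia.
  have [Y_k|Ynk] := eqVneq Y k%:Z.
    have /rowk : Q X%:~R k%:R by rewrite pmulrn -Y_k.
    move=> /andP[mX XM]; apply/orP; right; apply/orP; right; apply/orP; left.
    apply/mapP; exists (absz (X - mk)); first by rewrite mem_iota; lia.
    by rewrite aE Y_k; congr phi; lia.
  pose i := absz Y; have YE : Y = i%:Z by rewrite /i; lia.
  have i_bd : (0 < i < k)%N by lia.
  have i_in : i \in index_iota 1 k by rewrite mem_index_iota.
  rewrite YE -pmulrn in Qa.
  have [fX eX] := f_min i_bd Qa.
  have [fX' eX'] : f' i <= - X /\ (- X = f' i -> e' i).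
    by apply: (f'_min i_bd); rewrite rmorphN opprK.
  have [Xf|Xf] := eqVneq X (f i).
    apply/orP; right; apply/orP; right; apply/orP; right; apply/orP; left.
    by apply/mapP; exists i; rewrite ?mem_filter ?eX // aE Xf YE.
  have [Xf'|Xf'] := eqVneq (- X) (f' i).
    apply/orP; right; apply/orP; right; apply/orP; right; apply/orP; right.
    apply/mapP; exists i; first by rewrite mem_filter eX'.
    by rewrite aE -Xf' opprK YE.
  apply/orP; left; rewrite (lattice_pointsP _ polP); last exact: interior_subset.
  by apply/asboolP; apply: (interior_lattice_row i_bd YE); lia.
rewrite !size_cat !size_map !size_iota !sizeF.
lia.
Qed.
End Counting.

(** * Dimension of the cones in the presence of lattice columns *)

Lemma det3_coords (A : {fset 'cV[int]_2}) X Y (p q r : A) :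
  unimodular_coords X Y -> det3 (X \o val) (Y \o val) p q r != 0 ->
  det3 (coord0 \o val) (coord1 \o val) p q r != 0.
Proof.
move=> [m [n [s [u [v [w [_ XE YE]]]]]]].
by rewrite (det3_coordsE XE YE) mulf_eq0 negb_or => /andP[].
Qed.

Lemma unimodular_coords_inj X Y (a b : 'cV[int]_2) :
  unimodular_coords X Y -> X a = X b -> Y a = Y b -> a = b.
Proof.
move=> [m [n [s [u [v [w [det1 XE YE]]]]]]]; rewrite !XE !YE.
exact: lattice_coords_inj.
Qed.

Lemma regular_triple (R : realType) (A : {fset 'cV[int]_2})
    (D : {set {set A}}) :
  regular_unimodular R D -> exists p q r : A,
    det3 (coord0 \o val) (coord1 \o val) p q r != 0.
Proof.
move=> [c indc].
have [T maxT _] : {T : {set A} | maxset [pred U | `[< exists v, U = dual_cell c v >]] T &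
    dual_cell c 0 \subset T}.
  by apply: maxset_exists; apply/asboolP; exists 0.
have TD : T \in D by case: indc => <- _; rewrite inE.
have [p [q [r [_ det1]]]] := triangle_unimodular (planar_triangulation_std indc) TD.
by exists p, q, r; apply: contra_eqN det1 => /eqP->.
Qed.

(** The shear that straightens the side is absorbed into [X], so the column is always the line
    [X = 0]. *)
Definition column_side (A : {fset 'cV[int]_2}) (X Y : 'cV[int]_2 -> int)
    (k : nat) : Prop :=
  [/\ unimodular_coords X Y, forall a : A, 0 <= X (val a) &
      forall j, (j <= k)%N -> exists2 a : A, X (val a) = 0 & Y (val a) = j%:Z].

Lemma column_side_point (R : realType) (A : {fset 'cV[int]_2})
    (D : {set {set A}}) X Y k :
  column_side A X Y k -> (1 < k)%N -> (forall a : A, 0 <= Y (val a) <= k%:Z) ->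
  regular_unimodular R D ->
  (exists a : A, 0 < X (val a)) /\ exists p : A,
    flat_star (X \o val) D p /\ (0 < Y (val p) < k%:Z \/
      exists2 q : A, X (val q) = 1 & Y (val q) = Y (val p)).
Proof.
move=> [XY X_ge0 X_col] k_gt1 Y_bd regD.
have X_gt0 : exists a : A, 0 < X (val a).
  apply: contrapT => noX.
  have X0 (a : A) : X (val a) = 0.
    apply/le_anti; rewrite X_ge0 andbT leNgt; apply/negP => Xa.
    by apply: noX; exists a.
  have [p [q [r /negP[]]]] := regular_triple regD.
  have [m [n [s [u [v [w [det1 XE YE]]]]]]] := XY.
  have := det3_coordsE XE YE p q r; rewrite {1}/det3 /= !X0 !subrr !mul0r subrr => /esym/eqP.
  by rewrite mulf_eq0 => /orP[/eqP d0|//]; rewrite d0 in det1.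
split=> //; have [c indc] := regD.
have triD := planar_triangulation_coords XY (planar_triangulation_std indc).
have inj (a b : A) : X (val a) = X (val b) -> Y (val a) = Y (val b) -> a = b.
  by move=> Xab Yab; apply/val_inj/(unimodular_coords_inj XY).
have [p star Yp] := column_point triD inj X_ge0 Y_bd X_gt0 (ltnW k_gt1) X_col.
by exists p.
Qed.

Lemma column_side_two (A : {fset 'cV[int]_2}) X Y k (p : A) :
  column_side A X Y k -> (1 < k)%N -> exists a b : A,
    [/\ X (val a) = 0, X (val b) = 0, Y (val a) != Y (val b), a != p & b != p].
Proof.
move=> [_ _ X_col] k_gt1.
have [a0 X0 Y0] := X_col 0%N isT; have [a1 X1 Y1] := X_col 1%N (ltnW k_gt1).
have [a2 X2 Y2] := X_col 2%N k_gt1.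
have [p0|p0] := eqVneq a0 p; last have [p1|p1] := eqVneq a1 p.
- exists a1, a2; rewrite Y1 Y2; split=> //; rewrite -p0.
  + by apply: contra_eqN Y1 => /eqP->; rewrite Y0.
  + by apply: contra_eqN Y2 => /eqP->; rewrite Y0.
- exists a0, a2; rewrite Y0 Y2; split=> //; rewrite -p1.
  by apply: contra_eqN Y2 => /eqP->; rewrite Y1.
- by exists a0, a1; rewrite Y0 Y1.
Qed.

Lemma moduli_cone_side (R : realType) (A : {fset 'cV[int]_2})
    (D : {set {set A}}) X Y k :
  column_side A X Y k -> (1 < k)%N -> (forall a : A, 0 <= Y (val a) <= k%:Z) ->
  regular_unimodular R D -> (cone_dim (moduli_cone R D) + 4 <= #|{: A}|)%N.
Proof.
move=> side k_gt1 Y_bd regD; have [XY _ _] := side.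
have [[b Xb] [p [star _]]] := column_side_point side k_gt1 Y_bd regD.
have [a1 [a2 [X1 X2 Y12 a1p a2p]]] := column_side_two p side k_gt1.
have := @moduli_cone_dim_le R A D [set p] regD; rewrite cards1; apply.
  by move=> a; rewrite inE => /eqP->; exists X, Y.
have Xp : X (val p) = 0 by case: star => q [e [e' []]].
exists a1, a2, b; rewrite !inE; split=> //.
  by apply: contraTneq Xb => ->; rewrite Xp.
apply: (det3_coords XY); rewrite /det3 /= X1 X2 subrr mul0r sub0r subr0 oppr_eq0.
by apply: mulf_neq0; [rewrite gt_eqF|rewrite subr_eq0 eq_sym].
Qed.

(** [al + be * Y] is the width of the row at height [Y]. It is nonnegative at 0 and [k], so
    vanishing at an inner height, or at two heights, would make it vanish identically. Thus the two
    sides share at most a corner. *)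
Lemma moduli_cone_two_sides (R : realType) (A : {fset 'cV[int]_2})
    (D : {set {set A}}) X X' Y k (al be : int) :
  column_side A X Y k -> column_side A X' Y k ->
  (forall a : A, X (val a) + X' (val a) = al + be * Y (val a)) ->
  (1 < k)%N -> (forall a : A, 0 <= Y (val a) <= k%:Z) ->
  regular_unimodular R D -> (cone_dim (moduli_cone R D) + 5 <= #|{: A}|)%N.
Proof.
move=> side side' sumX k_gt1 Y_bd regD.
have [XY X_ge0 X_col] := side; have [X'Y X'_ge0 _] := side'.
have [[b Xb] [p [star _]]] := column_side_point side k_gt1 Y_bd regD.
have [_ [p' [star' Yp']]] := column_side_point side' k_gt1 Y_bd regD.
have Xp : X (val p) = 0 by case: star => q [e [e' []]].
have X'p' : X' (val p') = 0 by case: star' => q [e [e' []]].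
have width_ge0 j : (j <= k)%N -> 0 <= al + be * j%:Z.
  by move=> jk; have [a Xa <-] := X_col j jk; rewrite -sumX Xa add0r X'_ge0.
have w0 := width_ge0 0%N isT; have wk := width_ge0 k (leqnn k).
have not_degenerate : ~ (al = 0 /\ be = 0).
  move=> [al0 be0]; have := sumX b; rewrite al0 be0 mul0r addr0.
  by have := X'_ge0 b; lia.
(* If [p'] were on both sides, its row would have width 0. This is impossible at an inner height,
   and at a corner because the row contains a point with [X' = 1]. *)
have Xp' : 0 < X (val p').
  rewrite lt_neqAle eq_sym X_ge0 andbT; apply/eqP => Xp'0.
  have := sumX p'; rewrite Xp'0 X'p' addr0.
  case: Yp' => [|[q X'q Yq]].
    move=> /andP[Y0 Yk] wp; apply: not_degenerate.
    by nia.
  by rewrite -Yq -sumX X'q; have := X_ge0 q; lia.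
have [a1 [a2 [X1 X2 Y12 a1p a2p]]] := column_side_two p side k_gt1.
have [b1 [b2 [X'1 X'2 Y'12 b1p' b2p']]] := column_side_two p' side' k_gt1.
(* The side [X = 0] supplies two of the noncollinear points. The third comes from the other side,
   which has two points besides [p'], not both on [X = 0]. *)
have [b' [b'p' Xb']] : exists b' : A, b' != p' /\ 0 < X (val b').
  have pos (a : A) : X (val a) <> 0 -> 0 < X (val a) by have := X_ge0 a; lia.
  have [X10|/eqP/pos] := eqVneq (X (val b1)) 0; last by exists b1.
  have [X20|/eqP/pos] := eqVneq (X (val b2)) 0; last by exists b2.
  case: not_degenerate; have := sumX b1; have := sumX b2.
  rewrite X10 X20 X'1 X'2 => e2 e1.
  have /eqP : be * (Y (val b1) - Y (val b2)) = 0 by lia.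
  rewrite mulf_eq0 subr_eq0 (negPf Y'12) orbF => /eqP be0.
  by rewrite be0 in e1 *; lia.
have pp' : p != p' by apply: contraTneq Xp' => <-; rewrite Xp.
have := @moduli_cone_dim_le R A D [set p; p'] regD; rewrite cards2 pp'; apply.
  move=> a; rewrite !inE => /orP[]/eqP->; first by exists X, Y.
  by exists X', Y.
have neq_p' (a : A) : X (val a) = 0 -> a != p'.
  by move=> Xa; apply: contraTneq Xp' => <-; rewrite Xa.
exists a1, a2, b'; rewrite !inE !negb_or a1p a2p b'p' !neq_p' //; split=> //.
  by rewrite andbT; apply: contraTneq Xb' => ->; rewrite Xp.
apply: (det3_coords XY); rewrite /det3 /= X1 X2 subrr mul0r sub0r subr0 oppr_eq0.
by apply: mulf_neq0; [rewrite gt_eqF|rewrite subr_eq0 eq_sym].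
Qed.

Lemma min_row (R : realType) (P : set 'cV[R]_2) (m n s u v w i : int) :
  lattice_polygon P -> `|m * v - n * u| = 1 ->
  (exists2 a, P (intmx R a) & u * coord0 a + v * coord1 a + w = i) ->
  exists z : int, planar_rel P m n s u v w z%:~R i%:~R /\
    forall z' : int, planar_rel P m n s u v w z'%:~R i%:~R -> z <= z'.
Proof.
move=> polP det1 [a0 Pa0 Ya0]; pose A := lattice_points P.
have inA a : P (intmx R a) -> a \in A.
  by move=> Pa; rewrite (lattice_pointsP _ polP) //; apply/asboolP.
have Aa0 := inA a0 Pa0; pose x0 : A := [` Aa0]%fset.
pose X (a : A) := m * coord0 (val a) + n * coord1 (val a) + s.
pose inrow (a : A) := u * coord0 (val a) + v * coord1 (val a) + w == i.
have x0P : inrow x0 by apply/eqP.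
have [a /eqP Ya amin] := @Order.TotalTheory.arg_minP _ _ _ x0 inrow X x0P.
exists (X a); split.
  exists (intmx R (val a)); last by rewrite !coordR_intmx Ya.
  by have := valP a; rewrite (lattice_pointsP _ polP) // => /asboolP.
move=> z' /(planar_rel_lattice det1)[b Pb [<- Yb]].
by apply: (amin [` inA b Pb]%fset); apply/eqP.
Qed.

Theorem theorem5p1 (R : realType) (P : set 'cV[R]_2) (g : nat) (d : R) :
  lattice_polygon P -> maximal_polygon P ->
  #|` lattice_points (interior P)| = g ->
  is_lattice_width P d -> 1 < d ->
  (moduli_dim P)%:R <= g%:R + 2 * g%:R / (d - 1) + 2 * d - 3.
Proof.
move=> polP _ gE width d_gt1.
have [m [n [s [u [v [w [k [det1 dE strip bot top]]]]]]]] := lattice_width_strip polP width.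
rewrite dE in d_gt1 *.
have k_gt1 : (1 < k)%N by rewrite ltr1n in d_gt1.
pose Q := planar_rel P m n s u v w.
have convQ : convex_rel Q by apply: planar_rel_convex.
pose Q' x y := Q (- x) y.
have convQ' : convex_rel Q'.
  move=> x y x' y' t Qx Qx' t01; rewrite /Q' opprD -!mulrN.
  exact: convQ.
have det1' : `|(- m) * v - (- n) * u| = 1.
  by rewrite !mulNr -opprD normrN.
have Q'E x y : planar_rel P (- m) (- n) (- s) u v w x y <-> Q' x y.
  have oppE z : coordR (- m) (- n) (- s) z = - coordR m n s z :> R.
    by rewrite /coordR !rmorphN; ring.
  by split=> -[z Pz [e1 e2]]; exists z => //; split=> //; move: e1; rewrite oppE; lra.
have [B boundX] := lattice_polygon_bounded m n s polP.
have QB x y : Q x y -> - B%:R <= x <= B%:R.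
  by move=> [z /boundX + [<- _]]; rewrite ler_norml.
have [m0 [Qm0 min0]] := min_row s polP det1 bot.
have [mk [Qmk mink]] := min_row s polP det1 top.
have [n0 [Qn0 min0']] := min_row (- s) polP det1' bot.
have [nk [Qnk mink']] := min_row (- s) polP det1' top.
move: Qn0 Qnk => /Q'E Qn0 /Q'E Qnk.
have {}min0' z : Q' z%:~R (0 : int)%:~R -> n0 <= z by move/Q'E/min0'.
have {}mink' z : Q' z%:~R (k%:Z)%:~R -> nk <= z by move/Q'E/mink'.
have [f [e [col [f_min f_lt sum_f colP]]]] := @side_bound R Q k m0 mk (- B%:R)
  convQ (fun x y Qx => proj1 (andP (QB x y Qx))) k_gt1 Qm0 Qmk min0 mink.
have QB' x y : Q' x y -> - B%:R <= x.
  by rewrite /Q' => /QB /andP[_]; lra.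
have [f' [e' [col' [f'_min f'_lt sum_f' colP']]]] := @side_bound R Q' k n0 nk (- B%:R)
  convQ' QB' k_gt1 Qn0 Qnk min0' mink'.
have row0 (z : int) : Q z%:~R 0 -> m0 <= z <= - n0.
  move=> Qz; rewrite min0 //= lerNr min0' // /Q' rmorphN opprK //.
have rowk (z : int) : Q z%:~R k%:R -> mk <= z <= - nk.
  move=> Qz; rewrite mink //= lerNr mink' // /Q' rmorphN opprK //.
have int_count := @interior_count R P m n s u v w k polP det1 f f' f_lt f'_lt m0 mk Qm0 Qmk.
have /andP[_ le0] := row0 _ Qm0; have /andP[_ lek] := rowk _ Qmk.
have A_count := @lattice_count R P m n s u v w k polP det1 strip f f' e e' f_min f'_min
  f_lt f'_lt m0 (- n0) mk (- nk) row0 rowk Qm0 Qmk le0 lek.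
rewrite gE in int_count A_count.
pose Y a := u * coord0 a + v * coord1 a + w.
pose X a := m * coord0 a + n * coord1 a + s.
have AP (a : lattice_points P) : P (intmx R (val a)).
  by have := valP a; rewrite (lattice_pointsP _ polP) // => /asboolP.
have Y_bd (a : lattice_points P) : 0 <= Y (val a) <= k%:Z.
  by have := strip _ (AP a); rewrite coordR_intmx ler0z pmulrn ler_int.
have QA (a : lattice_points P) : Q (X (val a))%:~R (Y (val a))%:~R.
  by exists (intmx R (val a)); [apply: AP|rewrite !coordR_intmx].
have AQ z (j : nat) : Q z%:~R j%:R -> exists2 a : lattice_points P, X (val a) = z & Y (val a) = j.
  rewrite pmulrn => /(planar_rel_lattice det1)[a Pa [Xa Ya]].
  have aA : a \in lattice_points P by rewrite (lattice_pointsP _ polP) //; apply/asboolP.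
  by exists [` aA]%fset.
have absY (a : lattice_points P) : (absz (Y (val a)) <= k)%N /\ Y (val a) = (absz (Y (val a)))%:Z.
  by have := Y_bd a; lia.
have left_side : col -> exists t, column_side (lattice_points P) (fun a => X a - m0 - t * Y a) Y k.
  move=> /colP[t tP]; exists t; split.
  - exists (m - t * u), (n - t * v), (s - m0 - t * w), u, v, w; split=> // [|a].
      by rewrite -det1; congr (`|_|); ring.
    by rewrite /X /Y; ring.
  - move=> a; have [ak aE] := absY a; have [_] := tP _ ak.
    by move=> /(_ (X (val a))); rewrite pmulrn -aE => /(_ (QA a)); lia.
  - by move=> j jk; have [/AQ[a Xa Ya] _] := tP j jk; exists a; rewrite // Xa Ya; ring.
have right_side : col' -> exists t, column_side (lattice_points P) (fun a => - X a - n0 - t * Y a) Y k.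
  move=> /colP'[t tP]; exists t; split.
  - exists (- m - t * u), (- n - t * v), (- s - n0 - t * w), u, v, w; split=> // [|a].
      by rewrite -det1 -[RHS]normrN; congr (`|_|); ring.
    by rewrite /X /Y; ring.
  - move=> a; have [ak aE] := absY a; have [_] := tP _ ak.
    move=> /(_ (- X (val a))); rewrite /Q' rmorphN opprK pmulrn -aE => /(_ (QA a)).
    by lia.
  - move=> j jk; have [] := tP j jk; rewrite /Q' -rmorphN => /AQ[a Xa Ya] _.
    by exists a; rewrite // Xa Ya; ring.
have cone_bound (D : {set {set lattice_points P}}) : regular_unimodular R D ->
    (cone_dim (moduli_cone R D) + (3 + col + col') <= #|` lattice_points P|)%N.
  move=> regD; rewrite cardfE.
  case colE: col; case col'E: col'.
  - have [t side] := left_side colE; have [t' side'] := right_side col'E.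
    apply: (@moduli_cone_two_sides R _ D _ _ _ k (- m0 - n0) (- t - t') side side') => //.
    by move=> a; ring.
  - have [t side] := left_side colE.
    exact: (@moduli_cone_side R _ D _ _ k side).
  - have [t side] := right_side col'E.
    exact: (@moduli_cone_side R _ D _ _ k side).
  - have [p [q [r det_neq0]]] := regular_triple regD.
    have := @moduli_cone_dim_le R _ D set0 regD; rewrite cards0; apply.
      by move=> a; rewrite inE.
    by exists p, q, r; rewrite !inE.
pose E := (\sum_(1 <= i < k) e i + \sum_(1 <= i < k) e' i)%N.
(* Multiplication by [k.-1] keeps the estimate in the integers. [col] and [col'] are the units not
   saved in the count, which [cone_bound] recovers in the rank. *)
have main : (k.-1)%:Z * (#|` lattice_points P|)%:Z <=
    (k.-1)%:Z * (g%:Z + 2 * k%:Z + col%:Z + col'%:Z) + 2 * g%:Z.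
  have sum_ff : \sum_(1 <= i < k) (- f' i - f i - 1) =
      - (\sum_(1 <= i < k) f' i) - (\sum_(1 <= i < k) f i) - (k.-1)%:Z.
    rewrite !sumrB sumrN; congr (_ - _).
    by rewrite sumr_const_nat subn1 natz.
  rewrite sum_ff in int_count.
  have := ler_wpM2l (isT : 0 <= (k.-1)%:Z) A_count.
  move: sum_f sum_f'; rewrite PoszD.
  by move: int_count; lia.
have k1E : (k.-1)%:R = k%:R - 1 :> R by rewrite -subn1 natrB // ltnW.
have k1_gt0 : 0 < k%:R - 1 :> R by rewrite subr_gt0.
apply: (big_ind (fun N => N%:R <= _ :> R)).
(* An empty maximum is 0, so the bound must be nonnegative; [k >= 2] suffices. *)
- have : (0 : R) <= g%:R by rewrite ler0n.
  have : 0 <= 2 * g%:R / (k%:R - 1) :> R by rewrite divr_ge0 ?mulr_ge0 ?ler0n // ltW.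
  by have : (2 : R) <= k%:R by [rewrite ler_nat]; lra.
- by move=> x y x_le y_le; rewrite /maxn; case: ifP.
move=> D /asboolP /cone_bound.
move: (cone_dim _) => N N_le.
have : (k.-1)%:Z * N%:Z <= (k.-1)%:Z * (g%:Z + 2 * k%:Z - 3) + 2 * g%:Z.
  have : (k.-1)%:Z * (N%:Z + (3 + col%:Z + col'%:Z)) <= (k.-1)%:Z * (#|` lattice_points P|)%:Z.
    by apply: ler_wpM2l => //; lia.
  by move: main; lia.
rewrite -(ler_int R) !rmorphD !rmorphM !rmorphD !rmorphN /= -!pmulrn k1E => le_N.
rewrite -(ler_pM2l k1_gt0); apply: le_trans le_N _.
have -> : (k%:R - 1) * (g%:R + 2 * g%:R / (k%:R - 1) + 2 * k%:R - 3) =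
  (k%:R - 1) * (g%:R + 2 * k%:R - 3) + 2 * g%:R :> R by field; rewrite gt_eqF.
by lra.
Qed.
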